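(* Let $T$ be an ergodic measure-preserving transformation of a standard probability space $(X,\mu)$. Then the $\mathrm L^1$ full group $[T]_1$ of $T$ is amenable (as a topological group).
   Context: A standard probability space $(X,\mu)$ is a standard Borel space with a non-atomic Borel probability measure. $\mathrm{Aut}(X,\mu)$ is the group of measure-preserving Borel bijections of $X$, identified when they agree almost everywhere. $T$ is ergodic if every Borel set which is a union of $T$-orbits has measure $0$ or $1$ (then a.e. orbit is infinite). Set $[T]=\{U\in\mathrm{Aut}(X,\mu): U(x)\in\{T^n(x):n\in\mathbb Z\}\text{ for a.e. }x\}$; each $U\in[T]$ has a cocycle $c_U:X\to\mathbb Z$ defined by $U(x)=T^{c_U(x)}(x)$. The $\mathrm L^1$ full group is $[T]_1=\{U\in[T]:\int_X|c_U|\,d\mu<+\infty\}$, with the topology induced by the metric $\tilde d_T(U,V)=\int_X|c_U-c_V|\,d\mu$. A topological group is amenable if every continuous action of it on a (nonempty) compact Hausdorff space admits an invariant Borel probability measure. *)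

(* Defs.v *)
From HB Require Import structures.
From mathcomp Require Import all_boot all_order all_algebra generic_quotient.
From mathcomp Require Import all_classical all_reals all_analysis measurable_realfun.

Set Implicit Arguments.
Unset Strict Implicit.
Unset Printing Implicit Defensive.

Import Order.TTheory GRing.Theory Num.Theory.
Import numFieldNormedType.Exports.

Local Open Scope classical_set_scope.
Local Open Scope quotient_scope.
Local Open Scope ring_scope.

Section StandardBorel.
Variable R : realType.

Definition polish (P : metricType R) :=
  (exists2 D : set P, countable D & dense D) /\
  (forall F : set_system P, ProperFilter F -> cauchy F -> exists x : P, F --> x).

End StandardBorel.

(* The sigma-algebra of X is the Borel sigma-algebra of a Polish topology; the
   topology is transported along a bijection f with a Polish metric space P. *)
HB.mixin Record Measurable_isStandardBorel (R : realType) (d : measure_display)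
    X & Measurable d X := {
  standard_borelP : exists (P : metricType R) (f : X -> P),
    [/\ polish P, bijective f &
        @measurable d X = preimage_set_system setT f <<s @open P >>] }.

#[short(type="standardBorelType")]
HB.structure Definition StandardBorel (R : realType) (d : measure_display) :=
  {X of Measurable d X & Measurable_isStandardBorel R d X}.

Section EqualizerMeasurable.
Variables (R : realType).

Lemma metric_ball_open (P : metricType R) (p : P) (e : R) : open (ball p e).
Proof.
rewrite openE => y; rewrite ballEmdist /= => pye.
apply/nbhs_ballP; exists (e - mdist p y); first by rewrite /= subr_gt0.
move=> z; rewrite !ballEmdist /= ltrBrDl => yz.
exact: le_lt_trans (metric_triangle _ _ _) yz.
Qed.

Lemma measurable_equalizer (d : measure_display) (X : standardBorelType R d)
    (g h : X -> X) :
  measurable_fun setT g -> measurable_fun setT h ->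
  measurable [set x | g x = h x].
Proof.
move=> mg mh; have [P [f [[[D cD dD] _] [f' fK _] mE]]] := @standard_borelP R d X.
have mB (k : X -> X) (U : set P) : measurable_fun setT k -> open U ->
    measurable [set x | U (f (k x))].
  move=> mk oU.
  have mU : measurable (f @^-1` U).
    rewrite mE; exists U; last by rewrite setTI.
    exact: sub_sigma_algebra.
  by have := mk measurableT _ mU; rewrite setTI.
have -> : [set x | g x = h x] = ~` \bigcup_(p in D) \bigcup_(k : nat)
    ([set x | ball p k.+1%:R^-1 (f (g x))] `\`
     [set x | ball p k.+1%:R^-1 (f (h x))]).
  apply/seteqP; split=> x /=.
    by move=> e [p _ [k _ [/= +]]]; rewrite e.
  move=> N; apply: contrapT => gh; apply: N.
  set a := f (g x); set b := f (h x).
  have ab : 0 < mdist a b.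
    by rewrite mdist_gt0; apply/eqP => /(can_inj fK).
  have e0 : 0 < mdist a b / 2 by rewrite divr_gt0.
  have [k kE] : exists k : nat, k.+1%:R^-1 < mdist a b / 2.
    exists (Num.truncn (mdist a b / 2)^-1).
    rewrite -[ltRHS]invrK ltf_pV2 ?posrE ?invr_gt0 ?ltr0n //.
    exact: truncnS_gt.
  have k0 : 0 < k.+1%:R^-1 :> R by rewrite invr_gt0 ltr0n.
  have [] := dD (ball a k.+1%:R^-1) _ (metric_ball_open _ _).
    by exists a; exact: ballxx.
  move=> p [ap Dp]; exists p => //; exists k => //; split => /=.
    exact: ball_sym.
  move=> pb; have := ball_triangle ap pb; rewrite ballEmdist /=.
  apply/negP; rewrite -leNgt (splitr (mdist a b)) lerD // ltW //.
apply: measurableC; have /pfcard_geP[->|[q]] := cD.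
  by rewrite bigcup_set0; exact: measurable0.
rewrite -(image_eq q) bigcup_image; apply: bigcup_measurable => i _.
apply: bigcupT_measurable => k.
by apply: measurableD; apply: mB => //; exact: metric_ball_open.
Qed.

End EqualizerMeasurable.

Section Automorphisms.
Variables (R : realType) (d : measure_display) (X : measurableType d).
Variable mu : probability X R.

(* Measure-preserving Borel bijections of X, before identification modulo null
   sets. *)
Record mpaut := Mpaut {
  mpaut_fun :> X -> X;
  mpaut_inv : X -> X;
  mpautK : cancel mpaut_fun mpaut_inv;
  mpautVK : cancel mpaut_inv mpaut_fun;
  measurable_mpaut : measurable_fun setT mpaut_fun;
  measurable_mpaut_inv : measurable_fun setT mpaut_inv;
  mpaut_preserving :
    forall A, measurable A -> mu (mpaut_fun @^-1` A) = mu A }.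

HB.instance Definition _ := gen_eqMixin mpaut.
HB.instance Definition _ := gen_choiceMixin mpaut.

Definition mpaut_zpow (T : mpaut) (n : int) (x : X) : X :=
  match n with
  | Posz k => iter k T x
  | Negz k => iter k.+1 (mpaut_inv T) x
  end.

Definition nonatomic := forall A, measurable A -> (0 < mu A)%E ->
  exists B, [/\ measurable B, B `<=` A & (0 < mu B < mu A)%E].

Definition ergodic (T : mpaut) := forall A, measurable A ->
  (forall (x : X) (n : int), A x -> A (mpaut_zpow T n x)) ->
  mu A = 0%E \/ mu A = 1%E.

Lemma mpaut_id_preserving A : measurable A -> mu (@idfun X @^-1` A) = mu A.
Proof. by []. Qed.

Definition mpaut_id : mpaut :=
  @Mpaut idfun idfun (fun=> erefl) (fun=> erefl) (@measurable_id _ _ _)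
    (@measurable_id _ _ _) mpaut_id_preserving.

Lemma mpaut_comp_preserving (U V : mpaut) A :
  measurable A -> mu ((U \o V) @^-1` A) = mu A.
Proof.
move=> mA; rewrite comp_preimage mpaut_preserving ?mpaut_preserving //.
by rewrite -[_ @^-1` _]setTI; exact: measurable_mpaut.
Qed.

Definition mpaut_comp (U V : mpaut) : mpaut :=
  Mpaut (can_comp (mpautK U) (mpautK V)) (can_comp (mpautVK V) (mpautVK U))
    (measurableT_comp (measurable_mpaut U) (measurable_mpaut V))
    (measurableT_comp (measurable_mpaut_inv V) (measurable_mpaut_inv U))
    (@mpaut_comp_preserving U V).

Lemma mpaut_inv_preserving (U : mpaut) A :
  measurable A -> mu (mpaut_inv U @^-1` A) = mu A.
Proof.
move=> mA; rewrite -(mpaut_preserving U); last first.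
  by rewrite -[_ @^-1` _]setTI; exact: measurable_mpaut_inv.
by congr (mu _); apply/seteqP; split=> x /=; rewrite mpautK.
Qed.

Definition mpautV (U : mpaut) : mpaut :=
  Mpaut (mpautVK U) (mpautK U) (measurable_mpaut_inv U) (measurable_mpaut U)
    (@mpaut_inv_preserving U).

Lemma ae_mpaut (V : mpaut) (P : X -> Prop) :
  (\forall x \ae mu, P x) -> \forall x \ae mu, P (V x).
Proof.
move=> [N [mN N0 PN]]; exists (V @^-1` N); split.
- by rewrite -[_ @^-1` _]setTI; exact: measurable_mpaut.
- by rewrite mpaut_preserving.
- by move=> x nP; exact: PN.
Qed.

Definition mpaut_ae_eq (U V : mpaut) : bool :=
  `[< \forall x \ae mu, U x = V x >].

Lemma mpaut_ae_eq_refl : reflexive mpaut_ae_eq.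
Proof. by move=> U; apply/asboolP; apply: aeW. Qed.

Lemma mpaut_ae_eq_sym : symmetric mpaut_ae_eq.
Proof. by move=> U V; apply/asboolP/asboolP; apply: filterS => x ->. Qed.

Lemma mpaut_ae_eq_trans : transitive mpaut_ae_eq.
Proof.
move=> V U W /asboolP UV /asboolP VW; apply/asboolP.
by apply: filterS2 UV VW => x -> ->.
Qed.

Canonical mpaut_equiv :=
  EquivRel mpaut_ae_eq mpaut_ae_eq_refl mpaut_ae_eq_sym mpaut_ae_eq_trans.

Definition Aut := {eq_quot mpaut_equiv}.

HB.instance Definition _ := Choice.on Aut.
HB.instance Definition _ := EqQuotient.on Aut.

Local Notation class := (\pi_Aut).

Lemma Aut_eqP (U V : mpaut) :
  class U = class V <-> \forall x \ae mu, U x = V x.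
Proof.
split=> [/eqP|UV]; first by rewrite eqmodE => /asboolP.
by apply/eqP; rewrite eqmodE; apply/asboolP.
Qed.

Lemma repr_class (U : mpaut) : \forall x \ae mu, (repr (class U) : mpaut) x = U x.
Proof. by apply/Aut_eqP; rewrite reprK. Qed.

Definition Aut_one : Aut := class mpaut_id.
Definition Aut_mul (U V : Aut) : Aut := class (mpaut_comp (repr U) (repr V)).
Definition Aut_inv (U : Aut) : Aut := class (mpautV (repr U)).

Lemma Aut_mulE U V :
  Aut_mul (class U) (class V) = class (mpaut_comp U V).
Proof.
apply/Aut_eqP; have := ae_mpaut V (repr_class U).
by apply: filterS2 (repr_class V) => x /= -> ->.
Qed.

Lemma Aut_mulA : associative Aut_mul.
Proof.
move=> U V W; rewrite -[U]reprK -[V]reprK -[W]reprK.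
rewrite (Aut_mulE (repr V) (repr W)) (Aut_mulE (repr U) (repr V)) !Aut_mulE.
by apply/Aut_eqP; apply: aeW.
Qed.

Lemma Aut_mul1 : left_id Aut_one Aut_mul.
Proof. by move=> U; rewrite -[U]reprK Aut_mulE; apply/Aut_eqP; apply: aeW. Qed.

Lemma Aut_mulr1 : right_id Aut_one Aut_mul.
Proof. by move=> U; rewrite -[U]reprK Aut_mulE; apply/Aut_eqP; apply: aeW. Qed.

Lemma Aut_mulV : left_inverse Aut_one Aut_inv Aut_mul.
Proof.
move=> U; rewrite -[X in Aut_mul _ X]reprK Aut_mulE.
by apply/Aut_eqP; apply: aeW => x /=; rewrite mpautK.
Qed.

Lemma Aut_mulrV : right_inverse Aut_one Aut_inv Aut_mul.
Proof.
move=> U; rewrite -[X in Aut_mul X _]reprK Aut_mulE.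
by apply/Aut_eqP; apply: aeW => x /=; rewrite mpautVK.
Qed.

HB.instance Definition _ := isGroup.Build Aut Aut_mulA Aut_mul1 Aut_mulr1
  Aut_mulV Aut_mulrV.

Lemma repr_Aut1 : \forall x \ae mu, (repr (1%g : Aut) : mpaut) x = x.
Proof. exact: repr_class. Qed.

Lemma repr_AutM (U V : Aut) : \forall x \ae mu,
  (repr (U * V)%g : mpaut) x = (repr U : mpaut) ((repr V : mpaut) x).
Proof. exact: repr_class. Qed.

Lemma repr_AutV (U : Aut) : \forall x \ae mu,
  (repr (U^-1)%g : mpaut) x = mpaut_inv (repr U) x.
Proof. exact: repr_class. Qed.

Lemma mpaut_zpow1D (T : mpaut) (n : int) x :
  mpaut_zpow T (1 + n) x = T (mpaut_zpow T n x).
Proof.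
by case: n => [k|[|k]] //=; rewrite ?mpautVK ?subn1.
Qed.

Lemma mpaut_zpowN1D (T : mpaut) (n : int) x :
  mpaut_zpow T (-1 + n) x = mpaut_inv T (mpaut_zpow T n x).
Proof. by rewrite -[in RHS](addKr 1 n) addrCA mpaut_zpow1D mpautK. Qed.

Lemma mpaut_zpowD (T : mpaut) (m n : int) x :
  mpaut_zpow T (m + n) x = mpaut_zpow T m (mpaut_zpow T n x).
Proof.
elim/int_rec: m => [|m IH|m IH]; first by rewrite add0r.
  by rewrite intS -addrA !mpaut_zpow1D IH.
by rewrite intS opprD -addrA !mpaut_zpowN1D IH.
Qed.

Lemma measurable_zpow (T : mpaut) (n : int) :
  measurable_fun setT (mpaut_zpow T n).
Proof.
elim/int_rec: n => [|n IH|n IH]; first exact: measurable_id.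
  have -> : mpaut_zpow T n.+1 = T \o mpaut_zpow T n by [].
  exact: measurableT_comp (measurable_mpaut T) IH.
have -> : mpaut_zpow T (- n.+1%:Z) = mpaut_inv T \o mpaut_zpow T (- n%:Z).
  by apply/funext => x; rewrite intS opprD mpaut_zpowN1D.
exact: measurableT_comp (measurable_mpaut_inv T) IH.
Qed.

(* An integer of least absolute value with U x = T^n x.  When T is ergodic and mu
   non-atomic, a.e. T-orbit is infinite, and for U in [T] such an n is unique at
   a.e. x.  In the other cases the choice of least absolute value keeps [T]_1 a
   group. *)
Definition cocycle (T U : mpaut) (x : X) : int :=
  xget 0 [set n : int | U x = mpaut_zpow T n x /\
    forall m : int, U x = mpaut_zpow T m x -> `|n| <= `|m|].

Lemma cocycleP (T U : mpaut) (x : X) (n : int) : U x = mpaut_zpow T n x ->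
  U x = mpaut_zpow T (cocycle T U x) x /\ `|cocycle T U x| <= `|n|.
Proof.
move=> Un; suff : [set n : int | U x = mpaut_zpow T n x /\
    forall m : int, U x = mpaut_zpow T m x -> `|n| <= `|m|] (cocycle T U x).
  by move=> [e cmin]; split; [exact: e|exact: cmin].
apply: xgetPex.
have exk : exists k : nat,
    `[< exists2 m : int, `|m|%N = k & U x = mpaut_zpow T m x >].
  by exists `|n|%N; apply/asboolP; exists n.
case: (ex_minnP exk) => k /asboolP[m mk Um] kmin.
exists m; split=> // m' Um'.
by rewrite -!abszE lez_nat mk; apply: kmin; apply/asboolP; exists m'.
Qed.

Definition full_group (T : mpaut) : set Aut :=
  [set U : Aut | \forall x \ae mu,
    exists n : int, (repr U : mpaut) x = mpaut_zpow T n x].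

Definition L1_full_group_set (T : mpaut) : set Aut :=
  [set U : Aut | full_group T U /\
    (\int[mu]_x (`|cocycle T (repr U) x|%:~R : R)%:E < +oo)%E].

End Automorphisms.

Section L1FullGroup.
Variables (R : realType) (d : measure_display) (X : standardBorelType R d).
Variables (mu : probability X R) (T : mpaut mu).

Lemma measurable_cocycle_eq (U : mpaut mu) (n : int) : measurable [set x | cocycle T U x = n].
Proof.
pose E m := [set x | U x = mpaut_zpow T m x].
have mE m : measurable (E m).
  by apply: measurable_equalizer; [exact: measurable_mpaut|exact: measurable_zpow].
pose S x := [set k : int | U x = mpaut_zpow T k x /\
  forall m : int, U x = mpaut_zpow T m x -> `|k| <= `|m|].
have mS k : measurable [set x | S x k].
  have -> : [set x | S x k] =
      E k `\` \bigcup_m (if `|m| < `|k| then E m else set0).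
    apply/seteqP; split=> x /= [Ek Sk]; split=> //.
      by move=> [m _]; case: ifP => // mk Em; have := Sk _ Em; rewrite leNgt mk.
    move=> m Em; rewrite leNgt; apply/negP => mk; apply: Sk.
    by exists m => //; rewrite mk.
  apply: measurableD => //; apply: countable_bigcupT_measurable.
    exact: countableP.
  by move=> m; case: ifP => // _; exact: measurable0.
have SE x k : S x k -> S x `<=` [set k; - k].
  move=> [Ek kmin] m [Em mmin]; have := mmin _ Ek; have := kmin _ Em.
  move=> h1 h2; have /eqP : `|m| = `|k| by apply/le_anti; rewrite h1 h2.
  by rewrite eqr_norm2 => /orP[] /eqP ->; [left|right].
have -> : [set x | cocycle T U x = n] =
    ([set x | S x n] `&`
       (~` [set x | S x (- n)] `|` [set x | xget 0 [set n; - n] = n])) `|`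
    ([set x | n = 0] `\` \bigcup_k [set x | S x k]).
  apply/seteqP; split=> x /=; rewrite /cocycle -/(S x).
    case: xgetP => [c cE Sc|S0] cn; last first.
      by right; split; [rewrite cn|move=> [k _]; exact: S0].
    left; rewrite -cn; split => //.
    have [SN|] := pselect (S x (- c)); last by left.
    right; have <- : S x = [set c; - c].
      apply/seteqP; split; first exact: SE.
      by move=> m [->|->].
    by rewrite cE.
  move=> [[Sn [SN|nE]]|[n0 S0]].
  - apply: xget_unique => // m Sm; case: (SE _ _ Sn _ Sm) => // mN.
    by case: SN; rewrite -mN.
  - have [SN|SN] := pselect (S x (- n)).
      rewrite (_ : S x = [set n; - n]) //.
      apply/seteqP; split; first exact: SE.
      by move=> m [->|->].
    apply: xget_unique => // m Sm; case: (SE _ _ Sn _ Sm) => // mN.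
    by case: SN; rewrite -mN.
  - by rewrite n0; apply: xgetPN => k Sk; apply: S0; exists k.
apply: measurableU.
  apply: measurableI => //; apply: measurableU; first exact: measurableC.
  have [e|e] := pselect (xget 0 [set n; - n] = n).
    by rewrite (_ : [set x | _] = setT) //; apply/seteqP; split.
  by rewrite (_ : [set x | _] = set0) //; apply/seteqP; split.
apply: measurableD.
  have [e|e] := pselect (n = 0).
    by rewrite (_ : [set x | _] = setT) //; apply/seteqP; split.
  by rewrite (_ : [set x | _] = set0) //; apply/seteqP; split.
apply: countable_bigcupT_measurable => //; exact: countableP.
Qed.

Lemma measurable_cocycle (U : mpaut mu) :
  measurable_fun setT (fun x => (cocycle T U x)%:~R : R).
Proof.
move=> _ B mB; rewrite setTI.
rewrite (_ : _ @^-1` B = \bigcup_(n : int)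
    (if (n%:~R : R) \in B then [set x | cocycle T U x = n] else set0)).
  apply: countable_bigcupT_measurable; first exact: countableP.
  by move=> n; case: ifP => _; [exact: measurable_cocycle_eq|exact: measurable0].
apply/seteqP; split => x /=.
  by move=> Bx; exists (cocycle T U x) => //; rewrite mem_set.
by move=> [n _]; case: ifP => // /set_mem Bn /= ->.
Qed.

Lemma measurable_norm_cocycle (U : mpaut mu) :
  measurable_fun setT (EFin \o (fun x => `|cocycle T U x|%:~R : R)).
Proof.
apply/measurable_EFinP; under eq_fun do rewrite intr_norm.
exact: measurableT_comp (@normr_measurable _ _) (measurable_cocycle U).
Qed.

Lemma cocycle_ae_eq (U V : mpaut mu) : (\forall x \ae mu, U x = V x) ->
  \forall x \ae mu, cocycle T U x = cocycle T V x.
Proof. by apply: filterS => x; rewrite /cocycle => ->. Qed.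

Lemma norm_cocycle_integral_comp (U V : mpaut mu) :
  (\int[mu]_x (`|cocycle T U (V x)|%:~R : R)%:E =
   \int[mu]_x (`|cocycle T U x|%:~R : R)%:E)%E.
Proof.
have mV := measurable_mpaut V.
rewrite -[LHS](@ge0_integral_pushforward _ _ _ _ _ _ mV mu setT
  (fun y => (`|cocycle T U y|%:~R : R)%:E)) //.
- by apply: eq_measure_integral => A mA _; exact: mpaut_preserving.
- exact: measurable_norm_cocycle.
Qed.

Lemma L1_full_group_dominated (U : Aut mu) (g : X -> \bar R) :
  (forall x, (0 <= g x)%E) -> measurable_fun setT g ->
  (\int[mu]_x g x < +oo)%E ->
  (\forall x \ae mu, exists n : int,
    (repr U : mpaut mu) x = mpaut_zpow T n x /\ ((`|n|%:~R : R)%:E <= g x)%E) ->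
  L1_full_group_set T U.
Proof.
move=> g0 mg intg Ug; split.
  by apply: filterS Ug => x [n [? _]]; exists n.
apply: le_lt_trans intg; apply: ae_ge0_le_integral => //.
- exact: measurable_norm_cocycle.
- apply: filterS Ug => x [n [/cocycleP[_ cn] ng]] _.
  by apply: le_trans ng; rewrite lee_fin ler_int.
Qed.

Lemma L1_full_group1 : L1_full_group_set T 1%g.
Proof.
apply: (@L1_full_group_dominated _ (cst 0%E)) => //.
- by rewrite integral0 ltry.
- by apply: filterS (repr_Aut1 mu) => x Ux; exists 0; rewrite Ux /= normr0.
Qed.

Lemma L1_full_groupM (U V : Aut mu) :
  L1_full_group_set T U -> L1_full_group_set T V ->
  L1_full_group_set T (U * V)%g.
Proof.
move=> [UT Uoo] [VT Voo].
pose g x := ((`|cocycle T (repr U) ((repr V : mpaut mu) x)|%:~R : R)%:E +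
  (`|cocycle T (repr V) x|%:~R : R)%:E)%E.
have mV := measurable_norm_cocycle (repr V).
have mUV := measurableT_comp (measurable_norm_cocycle (repr U))
  (measurable_mpaut (repr V)).
apply: (@L1_full_group_dominated _ g).
- by move=> x; rewrite /g -EFinD lee_fin addr_ge0 // ler0z.
- exact: emeasurable_funD.
- rewrite /g ge0_integralD //.
  + rewrite norm_cocycle_integral_comp; exact: lte_add_pinfty.
- apply: filterS3 (repr_AutM U V) (ae_mpaut (repr V) UT) VT.
  move=> x -> [n /cocycleP[+ _]] [m /cocycleP[+ _]] => Un Vm.
  exists (cocycle T (repr U) ((repr V : mpaut mu) x) + cocycle T (repr V) x).
  rewrite mpaut_zpowD -Vm -Un; split => //.
  by rewrite /g -EFinD lee_fin -intrD ler_int ler_normD.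
Qed.

Lemma L1_full_groupV (U : Aut mu) :
  L1_full_group_set T U -> L1_full_group_set T (U^-1)%g.
Proof.
move=> [UT Uoo].
pose W := mpautV (repr U).
apply: (@L1_full_group_dominated _
  (fun x => (`|cocycle T (repr U) (W x)|%:~R : R)%:E)).
- by move=> x; rewrite lee_fin ler0z.
- exact: measurableT_comp (measurable_norm_cocycle _) (measurable_mpaut W).
- by rewrite norm_cocycle_integral_comp.
- apply: filterS2 (repr_AutV U) (ae_mpaut W UT).
  move=> x -> [n /cocycleP[+ _]] => Un.
  exists (- cocycle T (repr U) (W x)); rewrite normrN; split => //.
  rewrite -[LHS]/(mpaut_zpow T 0 (W x)) -(addNr (cocycle T (repr U) (W x))).
  by rewrite mpaut_zpowD -Un /= mpautVK.
Qed.

Definition L1_full_group_pred : {pred Aut mu} :=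
  fun U => `[< L1_full_group_set T U >].

Lemma L1_full_group_closed : group_closed L1_full_group_pred.
Proof.
split; first by apply/asboolP; exact: L1_full_group1.
move=> U V /asboolP LU /asboolP LV; apply/asboolP.
by apply: L1_full_groupM => //; exact: L1_full_groupV.
Qed.

Definition L1_full_group := {U : Aut mu | U \in L1_full_group_pred}.

HB.instance Definition _ := SubChoice.on L1_full_group.
HB.instance Definition _ :=
  SubChoice_isSubGroup.Build (Aut mu) L1_full_group_pred L1_full_group
    L1_full_group_closed.

Definition L1_cocycle (U : L1_full_group) (x : X) : R :=
  (cocycle T (repr (val U)) x)%:~R.

Definition L1_dist (U V : L1_full_group) : R :=
  \int[mu]_x `|L1_cocycle U x - L1_cocycle V x|.

Lemma L1_cocycle_integrable (U : L1_full_group) :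
  mu.-integrable setT (EFin \o L1_cocycle U).
Proof.
apply/integrableP; split; first exact/measurable_EFinP/measurable_cocycle.
have /asboolP[_] := valP U; under eq_integral do rewrite intr_norm.
by [].
Qed.

Lemma L1_dist_integrable (U V : L1_full_group) :
  mu.-integrable setT (EFin \o (fun x => `|L1_cocycle U x - L1_cocycle V x|)).
Proof.
have iUV := integrableB measurableT (L1_cocycle_integrable U)
  (L1_cocycle_integrable V).
by have := integrable_abse iUV.
Qed.

Lemma L1_distxx U : L1_dist U U = 0.
Proof.
rewrite /L1_dist; under eq_Rintegral do rewrite subrr normr0.
by rewrite Rintegral_cst // mul0r.
Qed.

Lemma L1_dist_sym U V : L1_dist U V = L1_dist V U.
Proof. by apply: eq_Rintegral => x _; rewrite distrC. Qed.

Lemma L1_dist_triangle V U W : L1_dist U W <= L1_dist U V + L1_dist V W.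
Proof.
rewrite /L1_dist -RintegralD //; try exact: L1_dist_integrable.
apply: le_Rintegral => //; first exact: L1_dist_integrable.
  exact: (integrableD measurableT (L1_dist_integrable _ _) (L1_dist_integrable _ _)).
by move=> x _; exact: ler_distD.
Qed.

Lemma L1_dist_eq0 U V : L1_dist U V = 0 -> U = V.
Proof.
move=> UV0; apply: val_inj; rewrite -[val U]reprK -[val V]reprK.
have : (\int[mu]_x `|(L1_cocycle U x - L1_cocycle V x)%:E| = 0)%E.
  rewrite -[LHS]fineK; last first.
    exact: (integrable_fin_num measurableT (L1_dist_integrable U V)).
  by rewrite -[X in X%:E]/(L1_dist U V) UV0.
move/ae_eq_integral_abs => /(_ measurableT) c0.
have {}c0 : \forall x \ae mu, (L1_cocycle U x - L1_cocycle V x)%:E = 0%E.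
  apply: filterS (c0 _); first by move=> x; apply.
  apply/measurable_EFinP; apply: measurable_funB; exact: measurable_cocycle.
have /asboolP[UT _] := valP U; have /asboolP[VT _] := valP V.
apply/Aut_eqP; apply: filterS3 c0 UT VT => x [/eqP].
rewrite subr_eq0 eqr_int => /eqP cUV [n /cocycleP[-> _]] [m /cocycleP[-> _]].
by rewrite cUV.
Qed.

HB.instance Definition _ := isMetric.Build R L1_full_group
  L1_distxx L1_dist_eq0 L1_dist_sym L1_dist_triangle.

End L1FullGroup.

(* Amenability only involves the group law and the topology, so continuity of the
   group operations is not part of the structure. *)
#[short(type="pretopologicalGroupType")]
HB.structure Definition PreTopologicalGroup := {G of Topological G & Group G}.

HB.instance Definition _ (R : realType) (d : measure_display)
  (X : standardBorelType R d) (mu : probability X R) (T : mpaut mu) :=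
  Topological.on (L1_full_group T).

Definition continuous_action (G : pretopologicalGroupType) (K : topologicalType)
    (act : G -> K -> K) :=
  [/\ forall x, act 1%g x = x,
      forall g h x, act (g * h)%g x = act g (act h x) &
      continuous (fun p : G * K => act p.1 p.2)].

(* K is nonempty because a ptopologicalType is pointed; R is the realType in which
   probability measures take their values. *)
Definition amenable (R : realType) (G : pretopologicalGroupType) :=
  forall (K : ptopologicalType) (act : G -> K -> K),
    compact [set: K] -> hausdorff_space K -> continuous_action act ->
    exists P : probability (g_sigma_algebraType (@open K)) R,
      forall (g : G) (A : set K), <<s @open K >> A -> P (act g @^-1` A) = P A.

(* Main.v *)
Require Import Defs.
From HB Require Import structures.
From mathcomp Require Import all_boot all_order all_algebra.
From mathcomp Require Import all_classical all_reals all_analysis.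
From mathcomp Require Import perm measurable_realfun.
From mathcomp Require Import zify lra.

(** The group satisfies a Folner condition adapted to topological groups, and
such a condition yields invariant measures on compact spaces.

From Folner to amenability ([folner_amenable]).  Averaging a point mass over
finite Folner families gives, on every compact space K on which the group acts,
finitely additive probabilities that are invariant up to a small error and a small
displacement.  A limit along an ultrafilter is a finitely additive m with
m (g^-1 W) <= m U whenever the closure of W lies in U.  The Borel measure
obtained by regularising m (inner approximation of open sets, then outer
approximation) is invariant ([invariant_regular_extension]).

The Folner families.  They consist of the products T^k phi with 0 <= k < N and
phi in a finite group Phi.  Let g be in the group, with cocycle c.  For almost
every y the map n |-> n + c (T^n y) is a bijection of the integers, and its net flow
across a cut (points crossing to the right minus points crossing to the left)
does not depend on the cut.  By ergodicity it is a constant r, and the integral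
of c is equal to it ([constant_flow]).  Hence
g T^k phi = T^(k + r) (T^(- k - r) g T^k) phi, where the middle factor has a cocycle
of integral 0, that is, balanced flow.  If every such balanced factor, for the
finitely many g and k at hand, is within delta of an element of Phi, then left
translation by g maps all but about |r| / N of the family close to itself,
because distances are invariant under right multiplication
([L1_full_group_folner]).

The finite group ([finite_group_approximation]).  A set B of small measure that
meets every orbit with bounded gaps ([exists_cut_set]) cuts the orbits into finite
intervals.  Phi permutes the points of each interval, by a permutation that
depends on finitely many patterns only.  A balanced h is approximated by following h
at the points which it keeps in their interval, and completing this partial
injection to a permutation.  Matching the free sources and free targets in
increasing order moves points by as much as the crossings of the partial
injection are unbalanced ([partial_perm_completion]), and since the total flow is
balanced, this imbalance is at most the flow of the points that leave their
interval.  Altogether the error is at most twice the integral of |h| over the leaving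
points ([displacement_cost]), which is small because h is integrable and a point with
|h x| <= K leaves its interval only within distance K of B
([excess_le_tail]). *)

Set Implicit Arguments.
Unset Strict Implicit.
Unset Printing Implicit Defensive.

Import Order.TTheory GRing.Theory Num.Theory.
Import numFieldNormedType.Exports.

Local Open Scope classical_set_scope.
Local Open Scope quotient_scope.
Local Open Scope ring_scope.

(** * Regular extension of a finitely additive measure *)

Section RegularExtension.
Variables (R : realType) (K : ptopologicalType).
Hypotheses (cptK : compact [set: K]) (hausK : hausdorff_space K).
Variable m : set K -> R.
Hypothesis m_ge0 : forall A, 0 <= m A.
Hypothesis m_setT : m setT = 1.
Hypothesis m_setU : forall A B, A `&` B = set0 -> m (A `|` B) = m A + m B.

Lemma closed_open_interpolation (A U : set K) : closed A -> open U ->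
  A `<=` U -> exists W, [/\ open W, A `<=` W & closure W `<=` U].
Proof.
move=> cA oU AU; have := compact_normal hausK cptK cA.
move=> /(_ U)[|V /set_nbhsP[W [oW AW WV]] VU].
  by apply/set_nbhsP; exists U; split.
exists W; split=> //; apply: subset_trans VU; exact: closureS.
Qed.

Let m_set0 : m set0 = 0.
Proof.
have := m_setU (set0I (@set0 K)); rewrite setU0 => /eqP.
by rewrite -subr_eq0 opprD addNKr oppr_eq0 => /eqP.
Qed.

Let m_le A B : A `<=` B -> m A <= m B.
Proof.
move=> AB; rewrite -(setDUK AB) m_setU ?lerDl //.
by apply/seteqP; split => x // [Ax []].
Qed.

Let m_leU A B : m (A `|` B) <= m A + m B.
Proof.
rewrite (_ : A `|` B = A `|` (B `\` A)); last first.
  apply/seteqP; split => x [|]; [by left| |by left|by case; right].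
  by move=> Bx; have [Ax|Ax] := pselect (A x); [left|right].
rewrite m_setU; last by apply/seteqP; split => x // [Ax []].
by rewrite lerD2l m_le // => x [].
Qed.

(** Inner regularisation. The closure of W is required inside U so that the
    approximate invariance of m, which only compares W with neighbourhoods of
    its closure, passes to it. *)
Let inner (U : set K) : \bar R :=
  ereal_sup [set (m W)%:E | W in [set W | open W /\ closure W `<=` U]].

Let inner_ub W U : open W -> closure W `<=` U -> ((m W)%:E <= inner U)%E.
Proof. by move=> oW WU; apply: ereal_sup_ubound; exists W. Qed.

Let inner_ge0 U : (0 <= inner U)%E.
Proof.
rewrite -[0%E]/(0%:E) -m_set0; apply: inner_ub; first exact: open0.
by rewrite closure0.
Qed.

Let inner_le1 U : (inner U <= 1)%E.
Proof.
apply: ge_ereal_sup => _ [W _ <-]; rewrite lee_fin -m_setT; exact: m_le.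
Qed.

Let inner_fin U : inner U \is a fin_num.
Proof.
by rewrite ge0_fin_numE //; apply: le_lt_trans (inner_le1 U) _; rewrite ltry.
Qed.

Let le_inner U V : U `<=` V -> (inner U <= inner V)%E.
Proof.
move=> UV; apply: ge_ereal_sup => _ [W [oW WU] <-].
by apply: inner_ub => //; exact: subset_trans UV.
Qed.

(** A set with closure in the union splits, by normality, into a part with
    closure in U and a part with closure in V. *)
Let inner_setU U V : open U -> open V ->
  (inner (U `|` V) <= inner U + inner V)%E.
Proof.
move=> oU oV; apply: ge_ereal_sup => _ [W [oW WUV] <-].
have [|x [Wx nVx]|W1 [oW1 W1s W1U]] :=
    @closed_open_interpolation (closure W `\` V) U _ oU.
- apply: closedI; first exact: closed_closure.
  exact: open_closedC.
- by have [] := WUV _ Wx.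
have [|x [Wx nW1x]|W2 [oW2 W2s W2V]] :=
    @closed_open_interpolation (closure W `\` W1) V _ oV.
- apply: closedI; first exact: closed_closure.
  exact: open_closedC.
- by apply: contrapT => nVx; apply/nW1x/W1s.
apply: (@le_trans _ _ (m (W1 `|` W2))%:E).
  rewrite lee_fin; apply: m_le => x Wx.
  have [|nW1x] := pselect (W1 x); first by left.
  by right; apply: W2s; split => //; exact: subset_closure.
apply: (@le_trans _ _ ((m W1)%:E + (m W2)%:E)%E).
  by rewrite -EFinD lee_fin.
by apply: leeD; exact: inner_ub.
Qed.

Let inner_set0 : inner set0 = 0%E.
Proof.
apply/eqP; rewrite eq_le inner_ge0 andbT.
apply: ge_ereal_sup => _ [W [_ W0] <-].
by rewrite lee_fin -m_set0; apply: m_le; exact: (subset_trans (@subset_closure _ W)).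
Qed.

(** Countable subadditivity is free from finite subadditivity: a closure
    inside the union is compact, hence inside a finite subunion. *)
Let inner_bigcup (U : (set K)^nat) : (forall n, open (U n)) ->
  (inner (\bigcup_n U n) <= \sum_(n <oo) inner (U n))%E.
Proof.
move=> oU; apply: ge_ereal_sup => _ [W [oW WU] <-].
pose V n := \big[setU/set0]_(i < n) U i.
have oV n : open (V n) by rewrite /V -bigcup_mkord; apply: bigcup_open.
have [N WV] : exists N, closure W `<=` V N.
  have cW : compact (closure W).
    by apply: (subclosed_compact _ cptK) => //; exact: closed_closure.
  move: cW; rewrite compact_cover => /(_ nat setT U)[//|//|D _ WD].
  exists (\max_(i <- finmap.enum_fset D) i).+1 => x /WD[i /= iD Uix].
  rewrite /V -bigcup_mkord; exists i => //=.
  by rewrite ltnS; apply: (leq_bigmax_seq (F := id)).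
have VN n : (inner (V n) <= \sum_(0 <= i < n) inner (U i))%E.
  elim: n => [|n ih]; first by rewrite /V big_ord0 inner_set0 big_nil.
  rewrite /V big_ord_recr /= big_nat_recr //=.
  by apply: (le_trans (inner_setU (oV n) (oU n))); rewrite leeD2r.
apply: (le_trans (inner_ub oW WV)); apply: (le_trans (VN N)).
by apply: nneseries_lim_ge.
Qed.

Let outer (A : set K) : \bar R :=
  ereal_inf [set inner U | U in [set U | open U /\ A `<=` U]].

Let outer_lb A U : open U -> A `<=` U -> (outer A <= inner U)%E.
Proof. by move=> oU AU; apply: ereal_inf_lbound; exists U. Qed.

Let outer_ge0 A : (0 <= outer A)%E.
Proof. by apply: le_ereal_inf_tmp => _ [U _ <-]. Qed.

Let outer_open U : open U -> outer U = inner U.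
Proof.
move=> oU; apply/eqP; rewrite eq_le outer_lb //=.
by apply: le_ereal_inf_tmp => _ [V [_ UV] <-]; exact: le_inner.
Qed.

Let le_outer : {homo outer : A B / A `<=` B >-> (A <= B)%E}.
Proof.
move=> A B AB; apply: le_ereal_inf_tmp => _ [U [oU BU] <-].
by apply: outer_lb => //; exact: subset_trans BU.
Qed.

Let outer_fin A : outer A \is a fin_num.
Proof.
rewrite ge0_fin_numE //; apply: le_lt_trans (le_outer (@subsetT _ A)) _.
rewrite outer_open; last exact: openT.
by apply: le_lt_trans (inner_le1 _) _; rewrite ltry.
Qed.

Let outer_approx A (e : R) : 0 < e ->
  exists U, [/\ open U, A `<=` U & (inner U <= outer A + e%:E)%E].
Proof.
move=> e0; have /(lb_ereal_inf_adherent e0) := outer_fin A.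
by move=> [_ [U [oU AU] <-] /ltW ?]; exists U.
Qed.

Let outer_sigma_subadditive : sigma_subadditive outer.
Proof.
move=> A; apply/lee_addgt0Pr => e e0.
rewrite (le_trans _ (@epsilon_trick R (outer \o A) e xpredT _ _)) //; [|by move=> n; exact: outer_ge0|exact: ltW].
have PU n : exists U, [/\ open U, A n `<=` U &
    (inner U <= outer (A n) + (e / (2 ^ n.+1)%:R)%:E)%E].
  by apply: outer_approx; rewrite divr_gt0 // ltr0n expn_gt0.
have [U UP] := choice PU.
apply: (@le_trans _ _ (inner (\bigcup_n U n))).
  apply: outer_lb; first by apply: bigcup_open => n _; have [] := UP n.
  by apply: subset_bigcup => n _; have [] := UP n.
apply: (le_trans (inner_bigcup _)); first by move=> n; have [] := UP n.
by apply: lee_nneseries => // n _; have [] := UP n.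
Qed.

HB.instance Definition _ := isOuterMeasure.Build R K outer
  (etrans (outer_open (@open0 K)) inner_set0) outer_ge0 le_outer
  outer_sigma_subadditive.

(** An approximant of the part of A in U and an approximant of A minus the
    closure of the former are disjoint, so that their m-values add up to at
    most the inner value of A. *)
Let open_caratheodory U : open U -> outer.-caratheodory U.
Proof.
move=> oU; apply: le_caratheodory_measurable => X /=.
apply: le_ereal_inf_tmp => _ [A [oA XA] <-].
apply: (@le_trans _ _ (outer (A `&` U) + outer (A `&` ~` U))%E).
  by apply: leeD; apply: le_outer; exact: setSI.
rewrite outer_open; last exact: openI.
rewrite -leeBrDr //; apply: ge_ereal_sup => _ [W [oW WAU] <-].
rewrite leeBrDr // addeC -leeBrDr //.
apply: (@le_trans _ _ (inner (A `\` closure W))).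
  apply: outer_lb; last by move=> x [Ax nUx]; split => // /WAU[].
  by apply: openI => //; apply: closed_openC; exact: closed_closure.
apply: ge_ereal_sup => _ [W' [oW' W'A] <-].
rewrite leeBrDr // -EFinD -m_setU; last first.
  apply/seteqP; split => x //= [W'x Wx].
  by have [_] := W'A _ (subset_closure W'x); apply; exact: subset_closure.
apply: inner_ub; first exact: openU.
by rewrite closureU => x [/W'A[]|/WAU[]].
Qed.

Let borel_caratheodory A : <<s @open K >> A -> outer.-caratheodory A.
Proof.
move: A; apply: smallest_sub; last exact: open_caratheodory.
split; first exact: (@measurable0 _ (caratheodory_type outer)).
  by move=> A mA; rewrite setTD; exact: (@measurableC _ (caratheodory_type outer)).
by move=> F mF; exact: (@bigcupT_measurable _ (caratheodory_type outer)).
Qed.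

Let P : set (g_sigma_algebraType (@open K)) -> \bar R := outer.

Let P_semi_sigma_additive : semi_sigma_additive P.
Proof.
move=> F mF tF mUF.
apply: (@caratheodory_measure_sigma_additive R K outer) => //.
  by move=> n; apply: borel_caratheodory; exact: mF.
exact: borel_caratheodory.
Qed.

HB.instance Definition _ := isMeasure.Build _ _ R P
  (etrans (outer_open (@open0 K)) inner_set0) outer_ge0 P_semi_sigma_additive.

Let P_setT : P setT = 1%E.
Proof.
rewrite /P outer_open; last exact: openT.
apply/eqP; rewrite eq_le inner_le1 /= -m_setT inner_ub //; exact: openT.
Qed.

HB.instance Definition _ := Measure_isProbability.Build _ _ R P P_setT.

(** The hypothesis is a weak invariance: m may increase under preimages, but
    not beyond any open neighbourhood of the closure. This slack disappears in
    the suprema over sets with closure in a given open set, and equality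
    follows by applying the inequality to the inverse as well. *)
Lemma invariant_regular_extension (G : Type) (act : G -> K -> K)
    (inv : G -> G) :
  (forall g, cancel (act g) (act (inv g))) ->
  (forall g, cancel (act (inv g)) (act g)) ->
  (forall g, continuous (act g)) ->
  (forall g W U, open W -> open U -> closure W `<=` U ->
     m (act g @^-1` W) <= m U) ->
  exists Q : probability (g_sigma_algebraType (@open K)) R,
    forall g A, <<s @open K >> A -> Q (act g @^-1` A) = Q A.
Proof.
move=> actK actVK cact mact.
have oact g U : open U -> open (act g @^-1` U).
  by move=> oU; apply: open_comp => // x _; exact: cact.
have pre g h A : cancel (act h) (act g) ->
    act h @^-1` (act g @^-1` A) = A.
  by move=> hg; apply/seteqP; split => x /=; rewrite hg.
have cle g h U : cancel (act g) (act h) -> cancel (act h) (act g) -> open U ->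
   (inner (act g @^-1` U) <= inner U)%E.
  move=> gh hg oU; apply: ge_ereal_sup => _ [W [oW WU] <-].
  have cWU : closure (act h @^-1` W) `<=` U.
    apply: (@subset_trans _ (act h @^-1` closure W)).
      have /closure_id -> : closed (act h @^-1` closure W).
        by apply: closed_comp => [x _|]; [exact: cact|exact: closed_closure].
      by apply: closureS => x Wx; exact: (@subset_closure _ W (act h x)).
    by move=> x /WU /=; rewrite hg.
  have [W' [oW' WW' W'U]] :=
    closed_open_interpolation (@closed_closure _ (act h @^-1` W)) oU cWU.
  apply: le_trans (inner_ub oW' W'U); rewrite lee_fin.
  by rewrite -(pre h g W) //; apply: mact => //; exact: oact.
have ole g h A : cancel (act g) (act h) -> cancel (act h) (act g) ->
   (outer (act g @^-1` A) <= outer A)%E.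
  move=> gh hg; apply: le_ereal_inf_tmp => _ [U [oU AU] <-].
  apply: le_trans (cle _ _ _ gh hg oU).
  by apply: outer_lb; [exact: oact|exact: preimage_subset].
exists P => g A _; apply/eqP; rewrite eq_le (ole _ (inv g)) //=.
by rewrite -{1}(pre g (inv g) A) // (ole _ g).
Qed.

End RegularExtension.

(** * A Folner condition implying amenability *)

Section FolnerAmenable.
Variables (R : realType) (G : pretopologicalGroupType).

(** A finite family f such that left translation by each g of L agrees, up to
    a V-small left factor and on all but a proportion e of the indices, with
    an injection s of the index set. Indexing instead of using finite subsets
    allows repetitions. *)
Definition topological_folner := forall (L : seq G) (V : set G) (e : R),
  nbhs 1%g V -> 0 < e ->
  exists (J : finType) (f : J -> G), (0 < #|J|)%N /\
    forall g, g \in L -> exists2 s : J -> J, injective s &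
      #|[set j | `[< ~ V (g * f j * (f (s j))^-1)%g >]]%SET|%:R <=
        e * #|J|%:R.

Lemma ultra_fmap (S S' : Type) (f : S -> S') (F : set_system S) :
  UltraFilter F -> UltraFilter (f @ F).
Proof.
move=> FU; split; first exact: fmap_proper_filter.
move=> H HF FH; apply/seteqP; split=> [B HB|]; last exact: FH.
have [//|FnB] := in_ultra_setVsetC (f @^-1` B) FU.
have /filter_ex[x []//] : H (B `&` ~` B).
by apply: filterI => //; apply: FH.
Qed.

Section Action.
Variables (K : ptopologicalType) (act : G -> K -> K).
Hypotheses (cptK : compact [set: K]) (hausK : hausdorff_space K).
Hypothesis (act_cont : continuous_action act).

Definition finitely_additive_probability (m : set K -> R) :=
  [/\ forall A, 0 <= m A, m setT = 1 &
      forall A B, A `&` B = set0 -> m (A `|` B) = m A + m B].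

(** Continuity of the action enters through the formulation: instead of
    comparing m (g^-1 W) with m W, it is compared with m U for any U that
    contains v^-1 W for all v in V. *)
Let approx_invariant (L : seq G) (V : set G) (e : R) (m : set K -> R) :=
  finitely_additive_probability m /\
  forall g W U, g \in L -> (forall v x, V v -> W (act v x) -> U x) ->
    m (act g @^-1` W) <= m U + e.

(** The mean is uniform over the translates of a base point by the Folner
    family: outside a proportion e of the indices, g (f j) x is a V-small
    translate of f (s j) x, and s is injective. *)
Let exists_approx_invariant L V e : topological_folner ->
  nbhs 1%g V -> 0 < e -> exists m, approx_invariant L V e m.
Proof.
move=> FG V1 e0; have [J [f [J0 fP]]] := FG L V e V1 e0.
have [act1 actM _] := act_cont.
pose S (A : set K) := [set j | `[< A (act (f j) point) >]]%SET.
have J0' : 0 < #|J|%:R^-1 :> R by rewrite invr_gt0 ltr0n.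
exists (fun A => #|S A|%:R / #|J|%:R); split; first split.
- by move=> A; rewrite divr_ge0.
- rewrite (_ : S setT = finset.setT) ?cardsT ?divff ?pnatr_eq0 -?lt0n //.
  by apply/setP => j; rewrite !inE; apply/asboolP.
- move=> A B AB; rewrite -mulrDl -natrD.
  congr (_%:R / _); rewrite -cardsUI [X in (_ + #|pred_of_set X|)%N](_ : _ = finset.set0).
    rewrite cards0 addn0; congr (#|pred_of_set _|); apply/setP => j; rewrite !inE.
    apply/asboolP/orP.
      by move=> [?|?]; [left|right]; apply/asboolP.
    by move=> [] /asboolP; [left|right].
  apply/setP => j; rewrite !inE; apply/negP => /andP[/asboolP a /asboolP b].
  by have : (A `&` B) (act (f j) point); [split|rewrite AB].
- move=> g W U gL VWU; have [s s_inj sP] := fP g gL.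
  rewrite -(ler_pM2r (_ : 0 < #|J|%:R)) ?ltr0n // mulrDl !divfK ?pnatr_eq0 -?lt0n //.
  apply: le_trans (_ : #|S U|%:R + #|[set j | `[< ~ V (g * f j * (f (s j))^-1)%g >]]%SET|%:R <= _); last first.
    by rewrite lerD2l.
  rewrite -natrD ler_nat.
  set B := [set j | `[< ~ V (g * f j * (f (s j))^-1)%g >]]%SET.
  apply: (@leq_trans (#|(s @^-1: S U)%SET :|: B|)%SET).
    apply: subset_leq_card; apply/fintype.subsetP => j; rewrite !inE => /asboolP /= Wj.
    apply/orP; have [Vj|] := pselect (V (g * f j * (f (s j))^-1)%g); last first.
      by right; apply/asboolP.
    left; apply/asboolP; apply: (VWU _ _ Vj).
    by rewrite -actM -mulgA mulVg mulg1 actM; apply/asboolP.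
  apply: leq_trans (leq_card_setU _ _) _; rewrite leq_add2r.
  rewrite -(card_imset _ s_inj); apply: subset_leq_card.
  by apply/fintype.subsetP => _ /imsetP[j + ->]; rewrite inE.
Qed.

(** Means taking values in [0, 1] on each set converge along an ultrafilter
    refining the approximate invariance conditions. Compactness provides a V
    such that v^-1 W stays in U for all v in V when the closure of W is in U. *)
Lemma exists_invariant_mean : topological_folner ->
  exists m, finitely_additive_probability m /\
    forall g W U, open U -> closure W `<=` U ->
      m (act g @^-1` W) <= m U.
Proof.
move=> FG; have [act1 actM act_c] := act_cont.
(* The filter base is indexed by the requirements (L, V, e). *)
pose D := [set i : seq G * set G * R | nbhs 1%g i.1.2 /\ 0 < i.2].
pose E (i : seq G * set G * R) := approx_invariant i.1.1 i.1.2 i.2.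
have EF : ProperFilter (filter_from D E).
  apply: filter_from_proper.
    apply: filter_from_filter.
      by exists ([::], setT, 1); split => //=; exact: filterT.
    move=> [[L V] e] [[L' V'] e'] [/= V1 e0] [/= V'1 e'0].
    exists (L ++ L', V `&` V', Num.min e e').
      by split => /=; [exact: filterI|rewrite lt_min e0].
    move=> m [mP mL]; split; split=> // g W U gL VWU.
      apply: le_trans (mL g W U _ _) _; first by rewrite mem_cat gL.
        by move=> v x [Vv _]; exact: VWU.
      by rewrite lerD2l ge_min lexx.
    apply: le_trans (mL g W U _ _) _; first by rewrite mem_cat gL orbT.
      by move=> v x [_ Vv]; exact: VWU.
    by rewrite lerD2l ge_min lexx orbT.
  move=> [[L V] e] [/= V1 e0]; exact: exists_approx_invariant.
have [F [FU EFF]] := ultraFilterLemma EF.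
have FE L V e : nbhs 1%g V -> 0 < e -> \forall m \near F, approx_invariant L V e m.
  by move=> V1 e0; apply: EFF; exists (L, V, e).
have Ffap : \forall m \near F, finitely_additive_probability m.
  by apply: filterS (FE [::] setT 1 filterT ltr01) => m [].
pose ev (A : set K) (m : set K -> R) := m A.
have /choice[m mP] : forall A, exists l : R, ev A @ F --> l.
  move=> A; have := @segment_compact R 0 1; rewrite compact_ultra.
  move=> /(_ (ev A @ F) (ultra_fmap _ FU)) [|l [_ ?]]; last by exists l.
  apply: filterS Ffap => m [m0 m1 mU] /=; rewrite in_itv /= m0 /= -m1.
  by rewrite -(setUv A) mU ?setICr // lerDl.
have fap : finitely_additive_probability m.
  split.
  - move=> A; apply: (cvgr_to_ge (mP A)); apply: filterS Ffap => m' [+ _ _]; exact.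
  - apply: (cvg_unique _ (mP setT)) => //.
    apply: (@cvg_trans _ ((fun=> 1) @ F)); last exact: cvg_cst.
    apply: near_eq_cvg; apply: filterS Ffap => m' [_ + _]; exact.
  - move=> A B AB; apply: (cvg_unique _ (mP _)) => //.
    apply: (@cvg_trans _ ((ev A + ev B) @ F)); last exact: cvgD.
    apply: near_eq_cvg; apply: filterS Ffap => m' [_ _ m'U].
    by rewrite /ev m'U.
exists m; split=> // g W U oU WU.
(* The complement of U is compact and at each of its points a neighbourhood of 1
   keeps the translates out of the closure of W. *)
have [V V1 VWU] : exists2 V, nbhs 1%g V & forall v x, V v -> W (act v x) -> U x.
  have cU : compact (~` U).
    by apply: (subclosed_compact _ cptK) => //; exact: open_closedC.
  have /compact_near_coveringP/(_ G (nbhs 1%g) (fun v x => ~ closure W (act v x)) _) := cU.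
  have nWx x : (~` U) x -> \forall y \near x & v \near nbhs 1%g, ~ closure W (act v y).
    move=> nUx; have nWx : (~` closure W) (act 1%g x) by rewrite act1 => /WU.
    have oW : open (~` closure W) by apply: closed_openC; exact: closed_closure.
    have [[V B] /= [V1 Bx] VB] := act_c (1%g, x) _ (open_nbhs_nbhs (conj oW nWx)).
    by exists (B, V) => //= -[y v] [/= By Vv]; exact: (VB (v, y)).
  move=> /(_ nWx) V1; 
  exists [set v | ~` U `<=` (fun x : K => ~ closure W (act v x))]; first exact: V1.
  move=> v x Vv Wx; apply: contrapT => nUx.
  by apply: (Vv _ nUx); exact: subset_closure.
apply/ler_addgt0Pr => e e0.
rewrite -subr_ge0.
apply: (cvgr_to_ge (cvgB (cvgD (mP U) (cvg_cst e)) (mP _))).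
apply: filterS (FE [:: g] V e V1 e0) => m' [_ m'P].
rewrite subr_ge0; apply: m'P => //.
by rewrite mem_head.
Qed.

End Action.

Theorem folner_amenable : topological_folner -> amenable R G.
Proof.
move=> FG K act cptK hausK act_cont.
have [m [[m0 m1 mU] mact]] := exists_invariant_mean cptK act_cont FG.
have [act1 actM act_c] := act_cont.
apply: (@invariant_regular_extension R K cptK hausK m m0 m1 mU G act (fun g => g^-1%g)).
- by move=> g x; rewrite -actM mulVg act1.
- by move=> g x; rewrite -actM mulgV act1.
- move=> g x; apply: (@cvg_comp _ _ _ (fun y => (g, y)) (fun p => act p.1 p.2) _ (nbhs (g, x))).
    by apply: cvg_pair; [exact: cvg_cst|exact: cvg_id].
  exact: (act_c (g, x)).
- by move=> g W U _ oU WU; exact: mact.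
Qed.

End FolnerAmenable.

(** * Functions with measurable level sets *)

Section LevelMeasurable.
Context (d : measure_display) (X : measurableType d).

(** For values in a countable type this is measurability for the discrete
    sigma-algebra. All the integer-valued and finite-valued data below
    (cocycles, lengths of intervals, patterns) are handled by this one notion. *)
Definition level_measurable (D : Type) (f : X -> D) :=
  forall v, measurable [set x | f x = v].

Lemma level_measurable_set (D : countType) (f : X -> D) (P : set D) :
  level_measurable f -> measurable [set x | P (f x)].
Proof.
move=> mf; rewrite (_ : [set x | _] = \bigcup_(v in P) [set x | f x = v]).
  rewrite bigcup_mkcond; apply: countable_bigcupT_measurable.
    exact: countableP.
  by move=> v; case: ifP => // _.
by apply/seteqP; split => [x Px|x [v Pv /= ->]] //; exists (f x).
Qed.

Lemma level_measurable_cst (D : Type) (v : D) : level_measurable (fun=> v).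
Proof.
move=> w; have [->|vw] := pselect (v = w).
  by rewrite (_ : [set x | _] = setT) //; apply/seteqP; split.
by rewrite (_ : [set x | _] = set0) //; apply/seteqP; split.
Qed.

Lemma level_measurable_comp (D : countType) (D' : Type) (k : D -> D')
  (f : X -> D) : level_measurable f -> level_measurable (k \o f).
Proof. by move=> mf w; exact: (level_measurable_set (fun v => k v = w) mf). Qed.

Lemma level_measurable_pair (D D' : Type) (f : X -> D) (g : X -> D') :
  level_measurable f -> level_measurable g ->
  level_measurable (fun x => (f x, g x)).
Proof.
move=> mf mg [v w].
rewrite (_ : [set x | _] = [set x | f x = v] `&` [set x | g x = w]).
  exact: measurableI.
by apply/seteqP; split => x /= [-> ->].
Qed.

Lemma level_measurable2 (D D' : countType) (D2 : Type) (k : D -> D' -> D2)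
    (f : X -> D) (g : X -> D') : level_measurable f -> level_measurable g ->
  level_measurable (fun x => k (f x) (g x)).
Proof.
move=> mf mg; exact: (level_measurable_comp (fun v => k v.1 v.2)
  (level_measurable_pair mf mg)).
Qed.

Lemma level_measurable_ffun (I : finType) (D : eqType) (f : I -> X -> D) :
  (forall i, level_measurable (f i)) ->
  level_measurable (fun x => [ffun i => f i x]).
Proof.
move=> mf v; rewrite (_ : [set x | _] =
    \bigcap_(i in [set: I]) [set x | f i x = v i]).
  by apply: fin_bigcap_measurable => // i _; exact: mf.
apply/seteqP; split => [x /= <- i _ /=|x fv]; first by rewrite ffunE.
by apply/ffunP => i; rewrite ffunE; exact: fv.
Qed.

Lemma level_measurable_asbool (A : set X) :
  measurable A -> level_measurable (fun x => `[<A x>]).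
Proof.
move=> mA; case.
  by rewrite (_ : [set x | _] = A) //; apply/seteqP; split => x /asboolP.
rewrite (_ : [set x | _] = ~` A); first exact: measurableC.
by apply/seteqP; split => x /=; [move=> /asboolPn|move=> ?; apply/asboolPn].
Qed.

Lemma level_measurable_fun (D : countType) d' (Y : measurableType d')
  (k : D -> Y) (f : X -> D) : level_measurable f ->
  measurable_fun setT (fun x => k (f x)).
Proof.
move=> mf _ B mB; rewrite setTI.
exact: (level_measurable_set (fun v => B (k v)) mf).
Qed.

Lemma measure_levels (R : realType) (mu : {measure set X -> \bar R})
    (b : X -> nat) (A : set X) : level_measurable b -> measurable A ->
  (mu A = \sum_(k <oo) mu (A `&` [set x | b x = k]))%E.
Proof.
move=> mb mA; rewrite -measure_semi_bigcup //.
- by congr (mu _); apply/seteqP; split => [x Ax|x [k _ []]//]; exists (b x).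
- by move=> k; apply: measurableI => //; exact: mb.
- apply/trivIsetP => i j _ _ /eqP ij; apply/seteqP; split => x //=.
  by move=> [[_ bi] [_ bj]]; apply: ij; rewrite -bi -bj.
- by apply: bigcupT_measurable => k; apply: measurableI => //; exact: mb.
Qed.

End LevelMeasurable.

(** * Powers of an ergodic automorphism *)

Section Powers.
Variables (R : realType) (d : measure_display) (X : standardBorelType R d).
Variables (mu : probability X R) (T : mpaut mu).

Local Notation "'T^' n" := (mpaut_zpow T n) (at level 8, n at level 2,
  format "'T^' n").

Lemma zpowK (n : int) : cancel (T^ n) (T^ (- n)).
Proof. by move=> x; rewrite -mpaut_zpowD addNr. Qed.

Lemma zpowNK (n : int) : cancel (T^ (- n)) (T^ n).
Proof. by move=> x; rewrite -mpaut_zpowD addrN. Qed.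

Lemma measurable_zpow_preimage (n : int) (A : set X) :
  measurable A -> measurable (T^ n @^-1` A).
Proof.
by move=> mA; rewrite -[_ @^-1` _]setTI; exact: measurable_zpow.
Qed.

Lemma zpow_preserving (n : int) (A : set X) : measurable A ->
  mu (T^ n @^-1` A) = mu A.
Proof.
move=> mA; elim/int_rec: n A mA => [//|n IH|n IH] A mA.
  rewrite (_ : T^ n.+1 @^-1` A = T^ n @^-1` (T @^-1` A)) //.
  rewrite IH ?mpaut_preserving // -[_ @^-1` _]setTI.
  exact: measurable_mpaut.
rewrite (_ : T^ (- n.+1%:Z) @^-1` A = T^ (- n%:Z) @^-1` (mpaut_inv T @^-1` A)).
  rewrite IH ?mpaut_inv_preserving // -[_ @^-1` _]setTI.
  exact: measurable_mpaut_inv.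
have e x : T^ (- n.+1%:Z) x = mpaut_inv T (T^ (- n%:Z) x).
  by rewrite intS opprD mpaut_zpowN1D.
by apply/seteqP; split => x; rewrite /preimage /mkset e.
Qed.

Definition zpow_mpaut (n : int) : mpaut mu :=
  Mpaut (zpowK n) (zpowNK n) (measurable_zpow T n) (measurable_zpow T (- n))
    (@zpow_preserving n).

Lemma ge0_integral_mpaut (V : mpaut mu) (f : X -> \bar R) :
  (forall x, (0 <= f x)%E) -> measurable_fun setT f ->
  (\int[mu]_x f (V x) = \int[mu]_x f x)%E.
Proof.
move=> f0 mf; have mV := measurable_mpaut V.
rewrite -[LHS](@ge0_integral_pushforward _ _ _ _ _ _ mV mu setT f) //.
by apply: eq_measure_integral => A mA _; exact: mpaut_preserving.
Qed.

Lemma level_measurable_zpow (D : Type) (f : X -> D) (n : int) :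
  level_measurable f -> level_measurable (fun x => f (T^ n x)).
Proof. by move=> mf v; exact: (measurable_zpow_preimage n (mf v)). Qed.

Lemma measurable_zpow_var (a : X -> int) (A : set X) :
  level_measurable a -> measurable A -> measurable [set x | A (T^ (a x) x)].
Proof.
move=> ma mA; rewrite (_ : [set x | _] =
    \bigcup_(n : int) ([set x | a x = n] `&` T^ n @^-1` A)).
  apply: countable_bigcupT_measurable; first exact: countableP.
  by move=> n; apply: measurableI => //; exact: measurable_zpow_preimage.
apply/seteqP; split => [x Ax|x [n _ [/= -> //]]]; by exists (a x).
Qed.

Lemma level_measurable_zpow_var (D : Type) (f : X -> D) (a : X -> int) :
  level_measurable f -> level_measurable a ->
  level_measurable (fun x => f (T^ (a x) x)).
Proof. by move=> mf ma v; exact: (measurable_zpow_var ma (mf v)). Qed.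

(** On each of the countably many pieces where a is constant, the map is a
    power of T, which preserves mu; bijectivity makes the images of these
    pieces disjoint. *)
Lemma piecewise_zpow_mpaut (a : X -> int) : level_measurable a ->
  bijective (fun x => T^ (a x) x) ->
  exists V : mpaut mu, forall x, V x = T^ (a x) x.
Proof.
move=> ma [V UK VK]; set U := fun x => _ in UK VK.
(* b is the exponent by which the inverse goes back. *)
pose b y := a (V y).
have VE y : V y = T^ (- b y) y 
  by rewrite -{1}(zpowK (b y) (V y)) -[T^ (b y) (V y)]/(U (V y)) VK.
have mb : level_measurable b.
  move=> n; rewrite (_ : [set y | _] = T^ (- n) @^-1` [set x | a x = n]).
    exact: measurable_zpow_preimage.
  apply/seteqP; split => y /=; first by move=> bn; rewrite -bn -VE.
  by move=> an; rewrite /b -[y in V y](zpowNK n) -{1}an -/(U _) UK.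
have mU : measurable_fun setT U.
  by move=> _ A mA; rewrite setTI; exact: measurable_zpow_var.
have mV : measurable_fun setT V.
  move=> _ A mA; rewrite setTI (_ : _ @^-1` _ = [set y | A (T^ (- b y) y)]).
    by apply: (@measurable_zpow_var (fun y => - b y)) => //; exact: level_measurable_comp.
  by apply/seteqP; split => y /=; rewrite -VE.
have pU A : measurable A -> mu (U @^-1` A) = mu A.
  move=> mA; rewrite (measure_levels mu (level_measurable_comp pickle ma)); last first.
    by rewrite -[_ @^-1` _]setTI; exact: mU.
    (* The pieces {a = n} and {b = n} correspond to each other under T^n. *)
rewrite (measure_levels mu (level_measurable_comp pickle mb) mA).
  apply: eq_eseriesr => k _ /=.
  have [[n nk]|nk] := pselect (exists n : int, pickle n = k); last first.
    congr (mu _); apply/seteqP; split => x [_ /= e]; exfalso; apply: nk.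
      by exists (a x).
    by exists (b x).
  rewrite -[RHS](zpow_preserving n); last first.
    by apply: measurableI => //; exact: (level_measurable_comp pickle mb k).
  congr (mu _); apply/seteqP; split => x /= [Ax ak].
    have an : a x = n by apply: (pcan_inj pickleK); rewrite nk.
    by rewrite /b -an -/(U x) UK an.
  have bn : b (T^ n x) = n by apply: (pcan_inj pickleK); rewrite nk.
  have xV : x = V (T^ n x) by rewrite VE bn zpowK.
  have an : a x = n by rewrite {1}xV.
  by rewrite /U an.
by exists (Mpaut UK VK mU mV pU).
Qed.

Hypotheses (mu_nonatomic : nonatomic mu) (T_ergodic : ergodic T).

(** A set of positive measure splits into two parts of positive measure, the
    smaller of which has at most half the measure; iterate from the whole
    space. *)
Lemma exists_small_set (e : R) : 0 < e ->
  exists A, [/\ measurable A, (0 < mu A)%E & (mu A < e%:E)%E].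
Proof.
move=> e0.
have half n : exists A, [/\ measurable A, (0 < mu A)%E & (mu A <= ((1 / 2) ^+ n)%:E)%E].
  elim: n => [|n [A [mA A0 An]]].
    by exists setT; rewrite probability_setT lte01 expr0.
  have [B [mB BA /andP[B0 BlA]]] := mu_nonatomic mA A0.
  have fA := fin_num_measure mu A mA; have fB := fin_num_measure mu B mB.
  have AB : mu (A `\` B) = (mu A - mu B)%E.
    rewrite measureD // ?(setIidr BA) //.
    by rewrite -ge0_fin_numE.
  move: An A0 B0 BlA; rewrite -(fineK fA) -(fineK fB) !lee_fin !lte_fin => An A0 B0 BlA.
  have [Bs|Bb] := leP (fine (mu B)) (fine (mu A) / 2).
    exists B; split=> //; rewrite -(fineK fB) ?lte_fin // lee_fin exprS.
    by apply: le_trans Bs _; move: An; set z := _ ^+ n; lra.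
  exists (A `\` B); split; first exact: measurableD.
    by rewrite AB -(fineK fA) -(fineK fB) -EFinB lte_fin subr_gt0.
  rewrite AB -(fineK fA) -(fineK fB) -EFinB lee_fin exprS.
  by move: An Bb; set z := _ ^+ n; lra.
have [n ne] : exists n, (1 / 2) ^+ n < e.
  exists (Num.truncn e^-1).+1; rewrite expr_div_n expr1n div1r invf_plt ?posrE //.
  apply: lt_le_trans (truncnS_gt _) _.
  by rewrite -natrX ler_nat; apply/ltnW/ltn_expl.
have [A [mA A0 An]] := half n; exists A; split=> //.
by apply: le_lt_trans An _; rewrite lte_fin.
Qed.

Lemma ae_probability (A : set X) : measurable A -> mu A = 1%E ->
  \forall x \ae mu, A x.
Proof.
move=> mA A1; exists (~` A); split => //; first exact: measurableC.
by rewrite probability_setC // A1 subee.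
Qed.

Lemma probability_ae (A : set X) : measurable A ->
  (\forall x \ae mu, A x) -> mu A = 1%E.
Proof.
move=> mA /(negligibleP _ (measurableC mA)) A0.
by rewrite -[A]setCK probability_setC ?A0 ?sube0 //; exact: measurableC.
Qed.

Lemma measurable_orbit (A : set X) : measurable A ->
  measurable [set x | exists k : int, A (T^ k x)].
Proof.
move=> mA; rewrite (_ : mkset _ = \bigcup_(k : int) T^ k @^-1` A).
  apply: countable_bigcupT_measurable; first exact: countableP.
  by move=> k; exact: measurable_zpow_preimage.
by apply/seteqP; split => x [k]; exists k.
Qed.

Lemma measure_orbit (A : set X) : measurable A -> (0 < mu A)%E ->
  mu [set x | exists k : int, A (T^ k x)] = 1%E.
Proof.
move=> mA A0; set A' := [set x | _].
have mA' : measurable A' by exact: measurable_orbit.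
have A'inv x n : A' x -> A' (T^ n x).
  move=> [k Ak]; exists (k - n).
  by rewrite -mpaut_zpowD -addrA addNr addr0.
have [A'0|//] := T_ergodic mA' A'inv.
move: A0; rewrite lt_neqAle => /andP[/eqP]; case.
apply/eqP; rewrite eq_le measure_ge0 /= -A'0 le_measure ?inE //.
by move=> x Ax; exists 0.
Qed.

(** The points of period n + 1 form an invariant set. If it had measure 1,
    then the points whose orbit meets a set A of measure below 1 / (n + 1)
    would be covered by n + 1 translates of A, while by ergodicity they have
    measure 1. *)
Lemma ae_aperiodic : \forall x \ae mu, forall n m : int,
  T^ n x = T^ m x -> n = m.
Proof.
have per0 (n : nat) : mu [set x | T^ n.+1 x = x] = 0%E.
  set E := [set x | _].
  have mE : measurable E.
    by apply: measurable_equalizer; [exact: measurable_zpow|exact: measurable_id].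
  have Ezpow x : E x -> forall q : int, T^ (q * n.+1%:Z) x = x.
    move=> Ex; elim/int_rec => [|q IH|q IH]; first by rewrite mul0r.
      by rewrite intS mulrDl mul1r mpaut_zpowD IH.
    by rewrite intS opprD mulrDl mpaut_zpowD IH mulN1r -{1}Ex zpowK.
  have Einv x (k : int) : E x -> E (T^ k x).
    move=> Ex; have e : T^ n.+1 (T^ k x) = T^ (n.+1%:Z + k) x by rewrite mpaut_zpowD.
    by rewrite /E /mkset e addrC mpaut_zpowD Ex.
  have [//|E1] := T_ergodic mE Einv.
  have n1 : 0 < n.+1%:R^-1 :> R by rewrite invr_gt0 ltr0n.
  have [A [mA A0 An]] := exists_small_set n1.
  pose A' := [set x | exists k : int, A (T^ k x)].
  have A'1 : mu A' = 1%E := measure_orbit mA A0.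
  pose F (i : nat) := T^ i @^-1` A.
  pose B := \big[setU/set0]_(i < n.+1) F i.
  have mB : measurable B.
    by apply: bigsetU_measurable => i _; exact: measurable_zpow_preimage.
  have : mu B = 1%E.
    apply: probability_ae => //; apply: filterS2 (ae_probability mE E1)
      (ae_probability (measurable_orbit mA) A'1) => x Ex [k Ak].
    rewrite /B -(bigcup_mkord n.+1 F); exists `|(k %% n.+1)%Z|%N.
      by rewrite /= -ltz_nat gez0_abs ?modz_ge0 // ltz_pmod.
    rewrite /F /preimage /mkset gez0_abs ?modz_ge0 //.
    move: Ak; rewrite {1}(divz_eq k n.+1) addrC mpaut_zpowD Ezpow //.
  move=> B1; have : (mu B <= \sum_(i < n.+1) mu A)%E.
    apply: (le_trans (Boole_inequality _ _)).
      by move=> i _; exact: measurable_zpow_preimage.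
    by apply: lee_sum => i _; rewrite le_eqVlt; apply/orP; left; apply/eqP; exact: zpow_preserving.
  move: An; rewrite B1 -(fineK (fin_num_measure mu A mA)) lte_fin => An.
  rewrite sumEFin sumr_const card_ord -mulr_natl.
  rewrite lee_fin leNgt => /negP; case.
  by rewrite mulrC -ltr_pdivlMr // ?div1r ?ltr0n.
have : \forall x \ae mu, forall n : nat, T^ n.+1 x <> x.
  apply/ae_foralln => n; exists [set x | T^ n.+1 x = x]; split=> //.
    by apply: measurable_equalizer; [exact: measurable_zpow|exact: measurable_id].
    exact: per0.
  by move=> x /= nx; apply: contrapT.
apply: filterS => x ap n m nm; apply/eqP; rewrite -subr_eq0; apply/eqP.
have : T^ (n - m) x = x by rewrite addrC mpaut_zpowD nm zpowK.
case: (n - m) => [[//|k] /ap//|k kx].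
by case: (ap k); rewrite -{1}kx (_ : k.+1%:Z = - (Negz k)) // zpowK.
Qed.

Section FirstVisit.
Variables (e : nat -> int) (A : set X).

(** The exponents e 0, e 1, ... list the powers of T in the order in which
    they are tried; backward and forward visits are both instances. *)
Definition first_visit_at (j : nat) (x : X) : Prop :=
  A (T^ (e j) x) /\ forall i, (i < j)%N -> ~ A (T^ (e i) x).

Definition first_visit (x : X) : option nat := xget None
  [set o | if o is Some j then first_visit_at j x
           else forall j, ~ first_visit_at j x].

Lemma first_visit_at_inj (i j : nat) x :
  first_visit_at i x -> first_visit_at j x -> i = j.
Proof.
by move=> [Ai ni] [Aj nj]; case: (ltngtP i j) => // [/nj|/ni].
Qed.

Lemma first_visit_spec (x : X) : if first_visit x is Some j
  then first_visit_at j x else forall j, ~ A (T^ (e j) x).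
Proof.
rewrite /first_visit; set S := [set o | _].
have Sx : S (xget None S).
  apply: xgetPex; have [[j vj]|nv] := pselect (exists j, first_visit_at j x).
    by exists (Some j).
  by exists None => j vj; apply: nv; exists j.
case: xgetP Sx => [v vE Sv _|S0 _].
  case: v {vE} Sv => [j //|] nv j Aj.
  have ex : exists j, `[< A (T^ (e j) x) >] by exists j; apply/asboolP.
  have [k /asboolP Ak kmin] := ex_minnP ex.
  apply: (nv k); split=> // i ik /asboolP /kmin.
  by rewrite leqNgt ik.
by have := S0 None; move=> N; exfalso; apply: N => j vj; exact: (S0 (Some j)).
Qed.

Lemma first_visitE (x : X) (j : nat) :
  first_visit x = Some j <-> first_visit_at j x.
Proof.
have := first_visit_spec x; case: first_visit => [i vi|nv].
  by split=> [[<-]//|/(first_visit_at_inj vi) ->].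
by split=> // -[/nv].
Qed.

Lemma first_visit_ex (x : X) (k : nat) : A (T^ (e k) x) ->
  exists j, (j <= k)%N /\ first_visit x = Some j.
Proof.
move=> Ak; have := first_visit_spec x; case: (first_visit x) => [j|/(_ k)//].
move=> [_ nj]; exists j; split=> //; rewrite leqNgt; apply/negP => /nj; exact.
Qed.

Lemma level_measurable_first_visit : measurable A ->
  level_measurable first_visit.
Proof.
move=> mA; have mS j : measurable [set x | first_visit x = Some j].
  rewrite (_ : [set x | _] = T^ (e j) @^-1` A `&`
      \bigcap_(i in `I_j) ~` (T^ (e i) @^-1` A)).
    apply: measurableI; first exact: measurable_zpow_preimage.
    apply: bigcap_measurableType => // i _; apply: measurableC.
    exact: measurable_zpow_preimage.
  by apply/seteqP; split => x /=; rewrite first_visitE.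
case=> [j|]; first exact: mS.
rewrite (_ : [set x | _] = ~` \bigcup_j [set x | first_visit x = Some j]).
  by apply: measurableC; exact: bigcupT_measurable.
apply/seteqP; split => x /=; first by move=> e0 [j _ /=]; rewrite e0.
by case E : (first_visit x) => [j|//] []; exists j.
Qed.

End FirstVisit.

Definition backward (j : nat) : int := - j%:Z.

Section BackwardVisit.
Variable A : set X.
Hypothesis mA : measurable A.

Local Notation first_visit := (first_visit backward A).
Local Notation first_visit_spec := (first_visit_spec backward A).
Local Notation level_measurable_first_visit :=
  (level_measurable_first_visit backward mA).

Lemma first_visit_shift (x : X) (i j : nat) : first_visit x = Some (i + j)%N ->
  first_visit (T^ (- i%:Z) x) = Some j.
Proof.
move=> /first_visitE[Aij nij]; apply/first_visitE; split.
  by rewrite -mpaut_zpowD -opprD -PoszD addnC.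
move=> k kj; rewrite -mpaut_zpowD -opprD -PoszD; apply: nij.
by rewrite addnC ltn_add2l.
Qed.

(** The set of points without a visit has the same measure as its preimages
    under T^n, which decrease to the points whose orbit avoids A, a null set
    by ergodicity. *)
Lemma ae_first_visit : (0 < mu A)%E -> \forall x \ae mu, first_visit x <> None.
Proof.
move=> A0; pose N := [set x | first_visit x = None].
have mN : measurable N by exact: level_measurable_first_visit.
exists N; split=> //; last by move=> x /= nx; apply: contrapT.
have NE x : N x <-> forall j : nat, ~ A (T^ (- j%:Z) x).
  split; first by move=> Nx; have := first_visit_spec x; rewrite Nx.
  move=> nA; have := first_visit_spec x; rewrite /N /=.
  by case: first_visit => // j [/nA].
pose F (n : nat) := T^ n @^-1` N.
have mF n : measurable (F n) by exact: measurable_zpow_preimage.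
have F0 : mu (\bigcap_n F n) = 0%E.
  have mI : measurable (\bigcap_n F n) by exact: bigcapT_measurable.
  apply/eqP; rewrite eq_le measure_ge0 andbT.
  have := probability_setC mu (measurable_orbit mA).
  rewrite (measure_orbit mA A0) subee // => <-.
  apply: le_measure; rewrite ?inE //.
    by apply: measurableC; exact: measurable_orbit.
  move=> x Fx [k Ak].
  have /NE/(_ `| `|k|%N%:Z - k|%N) := Fx `|k|%N I.
  rewrite -mpaut_zpowD; apply; rewrite (_ : _ + _ = k) //.
  lia.
have : mu \o F @ \oo --> mu (\bigcap_n F n).
  apply: nonincreasing_cvg_mu => //.
  - by rewrite (le_lt_trans (probability_le1 mu _)) // ltry.
  - exact: bigcapT_measurable.
  - apply/nonincreasing_seqP => n; apply/subsetPset => x /NE nx; apply/NE => j.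
    have := nx j.+1; rewrite -!mpaut_zpowD.
    by rewrite (_ : - j.+1%:Z + n.+1%:Z = - j%:Z + n%:Z) //; lia.
rewrite F0 (_ : mu \o F = fun=> mu N); last first.
  by apply/funext => n /=; rewrite /F zpow_preserving.
by move=> /(cvg_lim (@ereal_hausdorff R)) <-; rewrite lim_cst.
Qed.

(** The M translates by T^(- i), i < M, of this set are disjoint, since the
    translate by i has its first visit at a time congruent to - i modulo M. *)
Lemma measure_late_first_visit (M : nat) : (0 < M)%N ->
  (mu [set x | exists2 q, (0 < q)%N & first_visit x = Some (q * M)%N] <=
   (M%:R^-1)%:E)%E.
Proof.
move=> M0; pose S i := [set x | exists2 q, (0 < q)%N &
  first_visit x = Some (q * M - i)%N].
have mS i : measurable (S i).
  exact: (level_measurable_set (fun o => exists2 q, (0 < q)%N & o = Some (q * M - i)%N)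
    level_measurable_first_visit).
rewrite (_ : [set x | _] = S 0%N); last first.
  by apply/seteqP; split => x [q q0 e]; exists q => //; rewrite e subn0.
(* The i-th translate of S 0 is contained in S i, and the S i are disjoint. *)
have S0i i : (i < M)%N -> (mu (S 0%N) <= mu (S i))%E.
  move=> iM; rewrite -[leRHS](zpow_preserving (- i%:Z)) //.
  apply: le_measure; rewrite ?inE //; first exact: measurable_zpow_preimage.
  move=> x [q q0 e]; exists q => //; apply: first_visit_shift; rewrite e.
  by congr Some; nia.
have : (\sum_(i < M) mu (S 0%N) <= 1)%E.
  apply: (@le_trans _ _ (\sum_(i < M) mu (S i))%E).
    by apply: lee_sum => i _; exact: S0i.
  have tS : trivIset setT (fun i : 'I_M => S i).
    apply/trivIsetP => i j _ _ ij; apply/seteqP; split => x //=.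
    rewrite /S /mkset => -[[q q0 ->] [q' q'0 [e]]]; move/negP: ij; apply; apply/eqP/val_inj => /=.
    have iM := ltn_ord i; have jM := ltn_ord j.
    have qM : (M <= q * M)%N by rewrite leq_pmull.
    have q'M : (M <= q' * M)%N by rewrite leq_pmull.
    case: (ltngtP q q') => qq.
    - have : (q.+1 * M <= q' * M)%N by rewrite leq_mul2r qq orbT.
      by rewrite mulSn; lia.
    - have : (q'.+1 * M <= q * M)%N by rewrite leq_mul2r qq orbT.
      by rewrite mulSn; lia.
    - by move: e q'M; rewrite qq; lia.
  have /= <- := @measure_bigsetU_ord _ _ _ mu M xpredT _ (fun i => mS i) tS.
  by apply: probability_le1; apply: bigsetU_measurable.
rewrite -(fineK (fin_num_measure mu _ (mS 0%N))).
rewrite sumEFin sumr_const card_ord !lee_fin => h.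
by rewrite -[M%:R^-1]mul1r ler_pdivlMr ?ltr0n // mulr_natr.
Qed.

End BackwardVisit.

(** B consists of the points whose first backward visit to a small set A
    occurs at a multiple of M, and of the null set of points without a visit:
    going backwards from any point, B is reached within M steps, and B is
    contained in A up to a set of measure at most 1 / M and a null set. *)
Lemma exists_cut_set (e : R) : 0 < e -> exists (B : set X) (M : nat),
  [/\ measurable B, (mu B < e%:E)%E &
      forall x, exists2 i, (i < M)%N & B (T^ (- i%:Z) x)].
Proof.
move=> e0; have e2 : 0 < e / 2 by rewrite divr_gt0.
have [A [mA A0 Ae]] := exists_small_set e2.
pose M := (Num.truncn (e / 2)^-1).+1.
have Me : M%:R^-1 < e / 2.
  by rewrite invf_plt ?posrE ?ltr0n //; exact: truncnS_gt.
pose P (o : option nat) := if o is Some j then (M %| j)%N else true.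
pose B := [set x | P (first_visit backward A x)].
have mv := level_measurable_first_visit backward mA.
have mB : measurable B by exact: (level_measurable_set P mv).
exists B, M; split => //.
  pose C := [set x | exists2 q, (0 < q)%N & first_visit backward A x = Some (q * M)%N].
  have mC : measurable C.
    exact: (level_measurable_set (fun o => exists2 q, (0 < q)%N & o = Some (q * M)%N) mv).
  pose N := [set x | first_visit backward A x = None].
  have N0 : mu N = 0%E.
    apply/negligibleP; first exact: mv.
    by apply: negligibleS (ae_first_visit mA A0) => x Nx /(_ Nx).
  apply: (@le_lt_trans _ _ (mu ((A `|` C) `|` N))).
    apply: le_measure; rewrite ?inE //.
      by apply: measurableU; [exact: measurableU|exact: mv].
    move=> x; rewrite /B /P /=; have := first_visit_spec backward A x.
    case E : (first_visit backward A x) => [j|]; last by right.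
    move=> [Aj _] /dvdnP[q qE]; left; case: q qE => [|q] qE.
      by left; move: Aj; rewrite qE.
    by right; exists q.+1; rewrite // E qE.
  rewrite measureU0 //; [|exact: measurableU|exact: mv].
  apply: (le_lt_trans (measureU2 _ mA mC)).
  rewrite (splitr e) EFinD; apply: lte_leD => //.
    exact: fin_num_measure.
  by apply: le_trans (measure_late_first_visit mA _) _ => //; rewrite lee_fin ltW.
move=> x; case E : (first_visit backward A x) => [j|]; last first.
  by exists 0%N => //; rewrite /B /P /= E.
exists (j %% M)%N; first exact: ltn_pmod.
rewrite /B /P /= (@first_visit_shift _ _ _ (j %/ M * M)%N) ?dvdn_mull //.
by rewrite E addnC -divn_eq.
Qed.

End Powers.

(** * Cocycles and the L1 metric *)

Section Cocycles.
Variables (R : realType) (d : measure_display) (X : standardBorelType R d).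
Variables (mu : probability X R) (T : mpaut mu).
Hypotheses (mu_nonatomic : nonatomic mu) (T_ergodic : ergodic T).

Local Notation "'T^' n" := (mpaut_zpow T n) (at level 8, n at level 2,
  format "'T^' n").

Lemma ae_forall_count (I : countType) (P : I -> X -> Prop) :
  (forall i, \forall x \ae mu, P i x) -> \forall x \ae mu, forall i, P i x.
Proof.
move=> Pi; have : \forall x \ae mu, forall k : nat,
    if unpickle k is Some i then P i x else True.
  by apply/ae_foralln => k; case: unpickle => [i|]; [exact: Pi|exact: aeW].
by apply: filterS => x Px i; have := Px (pickle i); rewrite pickleK.
Qed.

Lemma ae_orbit (P : X -> Prop) : (\forall x \ae mu, P x) ->
  \forall x \ae mu, forall n : int, P (T^ n x).
Proof.
by move=> Px; apply: ae_forall_count => n; exact: (ae_mpaut (zpow_mpaut T n)).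
Qed.

(** The map x |-> T^(h x) x permutes almost every orbit; the orbit of y is
    identified with the integers by n |-> T^n y. *)
Definition orbit_bijective (h : X -> int) := \forall y \ae mu,
  (forall m n : int, m + h (T^ m y) = n + h (T^ n y) -> m = n) /\
  (forall k : int, exists n : int, n + h (T^ n y) = k).

Lemma orbit_bijective_shift (h : X -> int) (k r : int) : orbit_bijective h ->
  orbit_bijective (fun y => h (T^ k y) - r).
Proof.
move=> /(ae_mpaut (zpow_mpaut T k)); apply: filterS => y /= [hI hS].
split => [m n|j].
  rewrite -![T^ k (T^ _ y)]mpaut_zpowD ![k + _]addrC !mpaut_zpowD => mn.
  by apply: hI; lia.
have [n nE] := hS (j + r); exists n.
by rewrite -[T^ k (T^ _ y)]mpaut_zpowD [k + _]addrC mpaut_zpowD; lia.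
Qed.

Local Notation G := (L1_full_group T).

Definition action_of (g : G) : mpaut mu := repr (val g).

Definition cocycle_of (g : G) (x : X) : int := cocycle T (action_of g) x.

Lemma cocycle_ofP (g : G) :
  \forall x \ae mu, action_of g x = T^ (cocycle_of g x) x.
Proof.
have /asboolP[gT _] := valP g.
by apply: filterS gT => x [n /cocycleP[]].
Qed.

Lemma level_measurable_cocycle_of (g : G) : level_measurable (cocycle_of g).
Proof. exact: measurable_cocycle_eq. Qed.

Lemma cocycle_of_uniq (g : G) (a : X -> int) :
  (\forall x \ae mu, action_of g x = T^ (a x) x) ->
  \forall x \ae mu, cocycle_of g x = a x.
Proof.
move=> ga; apply: filterS3 (ae_aperiodic mu_nonatomic T_ergodic)
  (cocycle_ofP g) ga => x ap ->; exact: ap.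
Qed.

Lemma cocycle_ofM (g h : G) : \forall x \ae mu,
  cocycle_of (g * h)%g x = cocycle_of g (action_of h x) + cocycle_of h x.
Proof.
apply: cocycle_of_uniq; apply: filterS3 (repr_AutM (val g) (val h))
  (ae_mpaut (action_of h) (cocycle_ofP g)) (cocycle_ofP h) => x ghE gE hE.
by rewrite [LHS]ghE gE mpaut_zpowD -hE.
Qed.

(** Injectivity and surjectivity are those of the automorphism itself, read
    off in exponents, which are unique by aperiodicity. *)
Lemma orbit_bijective_cocycle_of (g : G) : orbit_bijective (cocycle_of g).
Proof.
have gV : \forall z \ae mu, exists m, mpaut_inv (action_of g) z = T^ m z.
  apply: filterS (ae_mpaut (mpautV (action_of g)) (cocycle_ofP g)) => z /=.
  rewrite mpautVK; set w := mpaut_inv _ z => zE.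
  by exists (- cocycle_of g w); rewrite zE zpowK.
apply: filterS3 (ae_aperiodic mu_nonatomic T_ergodic)
  (ae_orbit (cocycle_ofP g)) (ae_orbit gV) => y ap gE gVE; split=> [m n mn|k].
  apply: ap; apply: (can_inj (mpautK (action_of g))).
  by rewrite !gE -!mpaut_zpowD ![cocycle_of _ _ + _]addrC mn.
have [m mE] := gVE k; exists (m + k); apply: ap.
rewrite [X in T^ X _ = _]addrC [LHS]mpaut_zpowD -gE mpaut_zpowD -mE.
exact: mpautVK.
Qed.

Lemma exists_cocycle (a : X -> int) (M : nat) : level_measurable a ->
  (forall x, `|a x| <= M%:Z) -> bijective (fun x => T^ (a x) x) ->
  exists g : G, \forall x \ae mu, cocycle_of g x = a x.
Proof.
move=> ma aM abij; have [V VE] := piecewise_zpow_mpaut ma abij.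
pose U : Aut mu := \pi_(Aut mu) V.
have UV : \forall x \ae mu, (repr U : mpaut mu) x = T^ (a x) x.
  by apply: filterS (repr_class V) => x ->.
have LU : U \in L1_full_group_pred T.
  apply/asboolP; apply: (@L1_full_group_dominated _ _ _ _ _ _ (cst (M%:R)%:E)) => //.
  - by move=> x; rewrite lee_fin.
  - by rewrite integral_cst // [X in (_ * X)%E](probability_setT mu) mule1 ltry.
  - apply: filterS UV => x Ux; exists (a x); split => //.
    by rewrite lee_fin -[M%:R]/(M%:Z%:~R) ler_int.
by exists (exist _ U LU); apply: cocycle_of_uniq; exact: UV.
Qed.

Lemma mdistE (g h : G) : mdist g h =
  \int[mu]_x `|(cocycle_of g x)%:~R - (cocycle_of h x)%:~R| :> R.
Proof. by []. Qed.

(** Computing distances with any function that agrees almost everywhere with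
    the difference of cocycles avoids the particular choice of
    representatives. *)
Lemma mdist_ae_eq (g h : G) (f : X -> int) : level_measurable f ->
  (\forall x \ae mu, cocycle_of g x - cocycle_of h x = f x) ->
  (mdist g h)%:E = (\int[mu]_x (`|f x|%:~R)%:E)%E.
Proof.
move=> mf ghf; rewrite mdistE /Rintegral fineK; last first.
  exact: (integrable_fin_num measurableT (L1_dist_integrable g h)).
apply: ae_eq_integral => //.
- apply/measurable_EFinP.
  have := level_measurable_fun (fun p : int * int => `|p.1%:~R - p.2%:~R| : R)
    (level_measurable_pair (level_measurable_cocycle_of g) (level_measurable_cocycle_of h)).
  exact.
- exact: (level_measurable_fun (fun n : int => (`|n|%:~R)%:E) mf).
- by apply: filterS ghf => x <- _; rewrite intr_norm intrB.
Qed.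

Lemma integrable_cocycle_of (g : G) :
  (\int[mu]_x (`|cocycle_of g x|%:~R : R)%:E < +oo)%E.
Proof. by have /asboolP[] := valP g. Qed.

End Cocycles.

(** * Counting with infinite values *)

Section Counting.
Variable R : realType.

(** The number of indices satisfying b, possibly infinite. Values in the
    extended reals let counts be integrated without a finiteness proof. *)
Definition ecount (b : nat -> bool) : \bar R := (\sum_(n <oo) ((b n)%:R)%:E)%E.

Lemma ecount_ge0 b : (0 <= ecount b)%E.
Proof. by apply: nneseries_ge0 => n _ _; rewrite lee_fin. Qed.

Lemma ecountD (b b1 b2 : nat -> bool) : (forall n, b n = (b1 n + b2 n)%N :> nat) ->
  ecount b = (ecount b1 + ecount b2)%E.
Proof.
move=> bE; rewrite /ecount -nneseriesD //.
by apply: eq_eseriesr => n _; rewrite bE natrD.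
Qed.

Lemma eq_ecount b1 b2 : b1 =1 b2 -> ecount b1 = ecount b2.
Proof. by move=> /funext ->. Qed.

Lemma ecount_fin b N : (forall n, (N <= n)%N -> ~~ b n) ->
  ecount b = ((\sum_(n < N) b n)%:R)%:E.
Proof.
move=> bN; rewrite /ecount (@nneseries_split _ _ 0 N) => [|k _]; last by rewrite lee_fin.
rewrite [X in (_ + X)%E]eseries0 => [|n]; last first.
  by rewrite add0n => /bN /negbTE -> _.
by rewrite adde0 add0n big_mkord sumEFin natr_sum.
Qed.

Lemma ecount0 b : (forall n, ~~ b n) -> ecount b = 0%E.
Proof. by move=> b0; rewrite (@ecount_fin _ 0%N) ?big_ord0. Qed.

Lemma ecount_recl b :
  ecount b = (((b 0%N)%:R)%:E + ecount (fun n => b n.+1))%E.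
Proof.
rewrite /ecount (@nneseries_split _ _ 0 1) => [|k _]; last by rewrite lee_fin.
rewrite add0n big_nat1; congr (_ + _)%E.
apply/cvg_lim => //; rewrite -cvg_shiftS.
under eq_fun do rewrite big_add1 /=.
by apply: is_cvg_nneseries => n _ _; rewrite lee_fin.
Qed.

Lemma ecount1 b n0 : (forall n, b n = (n == n0)) -> ecount b = 1%E.
Proof.
move=> bE; rewrite (@ecount_fin _ n0.+1) => [|n]; last by rewrite bE; case: ltngtP.
rewrite big_ord_recr /= bE eqxx big1 // => i _.
by rewrite bE ltn_eqF.
Qed.

Lemma ecount_lt (c : bool) N :
  ecount (fun n => c && (n < N)%N) = ((if c then N else 0)%N%:R)%:E.
Proof.
case: c; last by rewrite ecount0.
rewrite (@ecount_fin _ N) => [|n]; last by rewrite /= -leqNgt.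
under eq_bigr do rewrite /= ltn_ord.
by rewrite sum_nat_const card_ord muln1.
Qed.

Lemma ecount_lty b : (ecount b < +oo)%E -> exists N : nat, ecount b = (N%:R)%:E.
Proof.
move=> boo; suff [M bM] : exists M, forall n, (M <= n)%N -> ~~ b n.
  by rewrite (ecount_fin bM); eexists.
apply: contrapT => nM.
have big k : exists N, (k <= \sum_(n < N) b n)%N.
  elim: k => [|k [N kN]]; first by exists 0%N.
  have [n Nn bn] : exists2 n, (N <= n)%N & b n.
    apply: contrapT => nn; apply: nM; exists N => n Nn; apply/negP => bn.
    by apply: nn; exists n.
  exists n.+1; rewrite big_ord_recr /= bn addn1 ltnS.
  apply: (leq_trans kN); rewrite -!(big_mkord xpredT (fun i => nat_of_bool (b i))).
  by rewrite [leqRHS](@big_cat_nat _ _ _ N) //= leq_addr.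
have [N] := big (Num.truncn (fine (ecount b))).+1.
have : (((\sum_(n < N) b n)%N%:R)%:E <= ecount b)%E.
  apply: le_trans (@nneseries_lim_ge _ _ xpredT 0 N _) => [|n _ _]; last by rewrite lee_fin.
  by rewrite big_mkord sumEFin natr_sum.
rewrite -[ecount b]fineK ?ge0_fin_numE ?ecount_ge0 // lee_fin => h1 h2.
have := truncnS_gt (fine (ecount b)); apply/negP; rewrite -leNgt.
by apply: le_trans h1; rewrite ler_nat.
Qed.

End Counting.

(** * The flow along an orbit *)

Section Flow.
Variables (R : realType) (d : measure_display) (X : standardBorelType R d).
Variables (mu : probability X R) (T : mpaut mu).
Hypothesis (T_ergodic : ergodic T).

Local Notation "'T^' n" := (mpaut_zpow T n) (at level 8, n at level 2,
  format "'T^' n").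

(** For the map x |-> T^(h x) x along the orbit of y: the current to the right
    through the cut just before y, carried by the points satisfying p. *)
Definition flow_right (h : X -> int) (p : X -> bool) (y : X) : \bar R :=
  ecount R (fun n => p (T^ (- n.+1%:Z) y) && (n.+1%:Z <= h (T^ (- n.+1%:Z) y))).

(** The opposite current through the same cut. *)
Definition flow_left (h : X -> int) (p : X -> bool) (y : X) : \bar R :=
  ecount R (fun n => p (T^ n y) && (h (T^ n y) < - n%:Z)).

Section Integrals.
Variables (h : X -> int) (p : X -> bool).
Hypotheses (mh : level_measurable h) (mp : level_measurable p).

Let measurable_flow_term (k : int) (Q : bool -> int -> bool) :
  measurable_fun setT (fun y => ((Q (p (T^ k y)) (h (T^ k y)))%:R : R)%:E).
Proof.
have := level_measurable_fun (fun v : bool * int => ((Q v.1 v.2)%:R : R)%:E)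
  (level_measurable_zpow T k (level_measurable_pair mp mh)).
exact.
Qed.

Lemma measurable_flow_right : measurable_fun setT (flow_right h p).
Proof.
have := @ge0_emeasurable_sum _ _ R setT (fun n y =>
  ((p (T^ (- n.+1%:Z) y) && (n.+1%:Z <= h (T^ (- n.+1%:Z) y)))%:R)%:E) xpredT.
apply=> [k x _ _|k _]; first by rewrite lee_fin.
exact: (measurable_flow_term _ (fun b m => b && (k.+1%:Z <= m))).
Qed.

Lemma measurable_flow_left : measurable_fun setT (flow_left h p).
Proof.
have := @ge0_emeasurable_sum _ _ R setT (fun n y =>
  ((p (T^ n y) && (h (T^ n y) < - n%:Z))%:R)%:E) xpredT.
apply=> [k x _ _|k _]; first by rewrite lee_fin.
exact: (measurable_flow_term _ (fun b m => b && (m < - k%:Z))).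
Qed.

Let integral_flow_count (k : nat -> int) (Q : nat -> bool -> int -> bool) :
  (\int[mu]_y ecount R (fun n => Q n (p (T^ (k n) y)) (h (T^ (k n) y))) =
   \int[mu]_y ecount R (fun n => Q n (p y) (h y)))%E.
Proof.
rewrite integral_nneseries // integral_nneseries //; last first.
  by move=> n; exact: (measurable_flow_term 0).
apply: eq_eseriesr => n _.
apply: (@ge0_integral_mpaut _ _ _ mu (zpow_mpaut T (k n))
  (fun z => ((Q n (p z) (h z))%:R)%:E)); first by move=> x; rewrite lee_fin.
exact: (measurable_flow_term 0).
Qed.

(** Mass transport: a point x with h x > 0 crosses exactly h x cuts, and the
    invariance of mu moves each crossing from the cut to the point that
    crosses it. *)
Lemma integral_flow_right : (\int[mu]_y flow_right h p y =
  \int[mu]_y ((if p y && (0 < h y)%R then `|h y|%N else 0)%N%:R)%:E)%E.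
Proof.
rewrite (integral_flow_count (fun n => - n.+1%:Z) (fun n b m => b && (n.+1%:Z <= m))).
apply: eq_integral => y _; rewrite -ecount_lt; apply: eq_ecount => n.
by case: (p y) => //=; lia.
Qed.

Lemma integral_flow_left : (\int[mu]_y flow_left h p y =
  \int[mu]_y ((if p y && (h y < 0)%R then `|h y|%N else 0)%N%:R)%:E)%E.
Proof.
rewrite (integral_flow_count (fun n => n%:Z) (fun n b m => b && (m < - n%:Z))).
apply: eq_integral => y _; rewrite -ecount_lt; apply: eq_ecount => n.
by case: (p y) => //=; lia.
Qed.

End Integrals.

(** Conservation: moving the cut from y to T y changes the net current by the
    point y that leaves and the point that arrives at y, and injectivity and
    surjectivity at y make these contributions equal. *)
Lemma flow_eq (h : X -> int) (y : X) :
  (forall m n : int, m + h (T^ m y) = n + h (T^ n y) -> m = n) ->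
  (exists n : int, n + h (T^ n y) = 0) ->
  (flow_right h xpredT (T^ 1 y) + flow_left h xpredT y =
   flow_right h xpredT y + flow_left h xpredT (T^ 1 y))%E.
Proof.
move=> hI [n0 hn0].
pose A := ecount R (fun n => n.+2%:Z <= h (T^ (- n.+1%:Z) y)).
pose B := ecount R (fun n => h (T^ (- n.+1%:Z) y) == n.+1%:Z).
pose C := ecount R (fun n => h (T^ n.+1 y) < - n.+1%:Z).
pose D := ecount R (fun n => h (T^ n.+1 y) == - n.+1%:Z).
have rT : flow_right h xpredT (T^ 1 y) = (((1%:Z <= h y)%R%:R)%:E + A)%E.
  rewrite /flow_right ecount_recl; congr (_ + _)%E.
    by rewrite [T^ (- 1) _]zpowK.
  by apply: eq_ecount => n; rewrite -mpaut_zpowD (_ : - n.+2%:Z + 1 = - n.+1%:Z) //; lia.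
have r : flow_right h xpredT y = (A + B)%E.
  by apply: ecountD => n /=; lia.
have l : flow_left h xpredT y = (((h y < 0)%R%:R)%:E + C)%E.
  by rewrite /flow_left ecount_recl /= oppr0.
have lT : flow_left h xpredT (T^ 1 y) = (C + D)%E.
  apply: ecountD => n; rewrite -mpaut_zpowD.
  by rewrite (_ : n%:Z + 1 = n.+1%:Z); lia.
have hnz : h y != 0 ->
    (((1%:Z <= h y)%R%:R)%:E + ((h y < 0)%R%:R)%:E = 1 :> \bar R)%E.
  by move=> hy; rewrite -EFinD -natrD (_ : (_ + _)%N = 1%N) //; lia.
(* The left side detects that y moves; the right side that the point arriving at
   y, unique by injectivity, comes from elsewhere.  Both hold, or y is fixed. *)
have key : (((1%:Z <= h y)%R%:R)%:E + ((h y < 0)%R%:R)%:E = B + D)%E.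
  case: n0 hn0 => [[|n0]|n0] hn0.
  - have hy : h y = 0 by rewrite -hn0 add0r.
    rewrite hy ltxx /B /D !ecount0 // => n; apply/negP => /eqP hn.
      by have := hI n.+1 0; rewrite hn hn0 addrN; lia.
    by have := hI (- n.+1%:Z) 0; rewrite hn hn0 addNr; lia.
  - have hy : h y != 0.
      apply/eqP => hy; have := hI 0 n0.+1; rewrite hn0 /= hy; lia.
    rewrite /B ecount0; last first.
      move=> n; apply/negP => /eqP hn.
      by have := hI (- n.+1%:Z) n0.+1; rewrite hn hn0; lia.
    rewrite /D (@ecount1 _ _ n0) => [|n].
      by rewrite add0e hnz.
    apply/eqP/eqP => [hn|->]; last by lia.
    by have := hI n.+1 n0.+1; rewrite hn hn0; lia.
  - have hy : h y != 0.
      apply/eqP => hy; have := hI 0 (Negz n0); rewrite hn0 /= hy; lia.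
    rewrite /D ecount0; last first.
      move=> n; apply/negP => /eqP hn.
      by have := hI n.+1 (Negz n0); rewrite hn hn0; lia.
    rewrite /B (@ecount1 _ _ n0) => [|n].
      by rewrite adde0 hnz.
    apply/eqP/eqP => [hn|->]; last by move: hn0; rewrite NegzE; lia.
    by have := hI (- n.+1%:Z) (Negz n0); rewrite hn hn0; lia.
by rewrite rT r l lT addeACA key [RHS]addeACA addeC.
Qed.

Lemma ge0_integral_lty_ae (f : X -> \bar R) : measurable_fun setT f ->
  (forall x, (0 <= f x)%E) -> (\int[mu]_x f x < +oo)%E ->
  \forall x \ae mu, (f x < +oo)%E.
Proof.
move=> mf f0 foo; have fi : mu.-integrable setT f.
  by apply/integrableP; split=> //; under eq_integral do rewrite gee0_abs //.
by apply: filterS (integrable_ae measurableT fi) => x /(_ I); rewrite ge0_fin_numE.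
Qed.

(** Both currents have finite integral, so the net current is almost
    everywhere a well-defined integer, constant along orbits by conservation
    ([flow_eq]) and thus almost everywhere constant by ergodicity. Its
    integral is that of h, by mass transport for the two currents. *)
Lemma constant_flow (h : X -> int) : level_measurable h -> orbit_bijective T h ->
  (\int[mu]_x (`|h x|%:~R : R)%:E < +oo)%E ->
  exists k : int, (\forall y \ae mu, flow_left h xpredT y \is a fin_num /\
      flow_right h xpredT y = flow_left h xpredT y + (k%:~R)%:E)%E /\
    (\int[mu]_x ((h x)%:~R : R)%:E = (k%:~R)%:E)%E.
Proof.
move=> mh hbij hint; set fr := flow_right h xpredT; set fl := flow_left h xpredT.
have mp : level_measurable (xpredT : X -> bool) by exact: level_measurable_cst.
have mfr : measurable_fun setT fr by exact: measurable_flow_right.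
have mfl : measurable_fun setT fl by exact: measurable_flow_left.
have fr0 y : (0 <= fr y)%E by exact: ecount_ge0.
have fl0 y : (0 <= fl y)%E by exact: ecount_ge0.
have mparts (Q : int -> nat) : measurable_fun setT (fun x => ((Q (h x))%:R : R)%:E).
  exact: (level_measurable_fun (fun n => ((Q n)%:R : R)%:E) mh).
have le_abs (Q : int -> nat) : (forall n, (Q n <= `|n|)%N) ->
    (\int[mu]_x ((Q (h x))%:R : R)%:E < +oo)%E.
  move=> Qn; apply: le_lt_trans hint; apply: ge0_le_integral => //.
  - exact: (level_measurable_fun (fun n : int => (`|n|%:~R : R)%:E) mh).
  - move=> x _; rewrite lee_fin -abszE pmulrn ler_nat; exact: Qn.
have Ifr := integral_flow_right mh mp; have Ifl := integral_flow_left mh mp.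
have Ifr_oo : (\int[mu]_y fr y < +oo)%E.
  by rewrite Ifr; apply: (le_abs (fun n => if true && (0 < n)%R then `|n|%N else 0%N)) => n; case: ifP.
have Ifl_oo : (\int[mu]_y fl y < +oo)%E.
  by rewrite Ifl; apply: (le_abs (fun n => if true && (n < 0)%R then `|n|%N else 0%N)) => n; case: ifP.
pose S0 (k : int) := [set y | fl y \is a fin_num /\ fr y = (fl y + (k%:~R)%:E)%E].
(* Requiring the value k along the whole orbit makes the set strictly invariant,
   as ergodicity is stated for such sets. *)
pose S (k : int) := [set y | forall n : int, S0 k (T^ n y)].
have mS0 k : measurable (S0 k).
  rewrite (_ : S0 k = (fl @^-1` [set x | x \is a fin_num]) `&`
      ((fun y => fr y - fl y)%E @^-1` [set (k%:~R)%:E])).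
    apply: measurableI.
      by have := emeasurable_fin_num measurableT mfl; rewrite setTI.
    rewrite -[_ @^-1` _]setTI; apply: emeasurable_funB => //.
  apply/seteqP; split => y /= [flf e]; split => //.
    by rewrite e addeAC subee // add0e.
  by rewrite -e addeC subeK.
have mS k : measurable (S k).
  rewrite (_ : S k = ~` \bigcup_(n : int) T^ n @^-1` (~` S0 k)).
    apply: measurableC; apply: countable_bigcupT_measurable; first exact: countableP.
    by move=> n; apply: measurable_zpow_preimage; exact: measurableC.
  apply/seteqP; split => y Sy; first by case=> n _; apply; exact: Sy.
  by move=> n; apply: contrapT => nS; apply: Sy; exists n.
have Sinv k y (n : int) : S k y -> S k (T^ n y).
  by move=> Sy m; rewrite -mpaut_zpowD; exact: Sy.
have aeS : \forall y \ae mu, exists k, S k y.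
  have := ae_orbit T (ge0_integral_lty_ae mfl fl0 Ifl_oo).
  have := ae_orbit T (ge0_integral_lty_ae mfr fr0 Ifr_oo).
  have := ae_orbit T hbij; apply: filterS3 => y hy fry fly.
  have [Nr Er] := ecount_lty (fry 0); have [Nl El] := ecount_lty (fly 0).
  have fle n : fl (T^ n y) \is a fin_num by rewrite ge0_fin_numE.
  have fre n : fr (T^ n y) \is a fin_num by rewrite ge0_fin_numE.
  have step n : fine (fr (T^ (1 + n) y)) + fine (fl (T^ n y)) =
      fine (fr (T^ n y)) + fine (fl (T^ (1 + n) y)).
    have [hI hS] := hy n; have [m hm] := hS 0.
    have := flow_eq hI (ex_intro _ m hm); rewrite -mpaut_zpowD -/fr -/fl.
    rewrite -(fineK (fle n)) -(fineK (fre n)) -(fineK (fle (1 + n))) -(fineK (fre (1 + n))).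
    by rewrite -!EFinD => -[].
  exists (Nr%:Z - Nl%:Z) => n; split; first exact: fle.
  rewrite -(fineK (fle n)) -(fineK (fre n)) -EFinD; congr EFin.
  elim/int_rec: n => [|n|n].
  - by rewrite /fr /fl /flow_right /flow_left Er El /= rmorphB /=; lra.
  - have := step n; rewrite intS; lra.
  - have := step (- n.+1%:Z).
    by rewrite (_ : 1 - n.+1%:Z = - n%:Z); [lra|lia].
have [k Sk1] : exists k, mu (S k) = 1%E.
  apply: contrapT => nk.
  have S0' k : mu (S k) = 0%E.
    by have [//|Sk1] := T_ergodic (mS k) (@Sinv k); exfalso; apply: nk; exists k.
  have : \forall y \ae mu, forall k, ~ S k y.
    apply: ae_forall_count => k; exists (S k); split=> // y /= nSy.
    exact: contrapT.
  move=> nS; have : \forall y \ae mu, False by apply: filterS2 aeS nS => y [k Sk] /(_ k).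
  by move=> /(probability_ae measurable0); rewrite measure0 => -[] /esym/eqP; rewrite oner_eq0.
exists k; have aeSk : \forall y \ae mu, S0 k y.
  by apply: filterS (ae_probability (mS k) Sk1) => y /(_ 0).
split=> //.
have fE : (\int[mu]_y fr y = \int[mu]_y fl y + (k%:~R)%:E)%E.
  have int_fr : mu.-integrable setT fr.
    by apply/integrableP; split=> //; under eq_integral do rewrite gee0_abs //.
  have int_fl : mu.-integrable setT fl.
    by apply/integrableP; split=> //; under eq_integral do rewrite gee0_abs //.
  have ik : mu.-integrable setT (fun=> (k%:~R : R)%:E).
    exact: finite_measure_integrable_cst.
  have -> : (\int[mu]_y fr y = \int[mu]_y (fl y + (k%:~R)%:E))%E.
    apply: ae_eq_integral => //; first by apply: emeasurable_funD.
    by apply: filterS aeSk => y [].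
  rewrite integralD // integral_cst //.
  by rewrite [X in (_ * X)%E](probability_setT mu) mule1.
rewrite integralE -[X in (X - _)%E](_ : \int[mu]_y fr y = _)%E; last first.
  rewrite Ifr; apply: eq_integral => y _; rewrite funeposE /=.
  rewrite -EFin_max; congr EFin; have [hy|hy] := ltP 0 (h y).
    by rewrite max_l ?ler0z ?ltW // pmulrn; congr (_%:~R); lia.
  by rewrite max_r // lerz0.
rewrite -[X in (_ - X)%E](_ : \int[mu]_y fl y = _)%E; last first.
  rewrite Ifl; apply: eq_integral => y _; rewrite funenegE /=.
  rewrite -EFin_max; congr EFin; have [hy|hy] := ltP (h y) 0.
    by rewrite max_l ?oppr_ge0 ?lerz0 ?ltW // -rmorphN pmulrn; congr (_%:~R); lia.
  by rewrite max_r // oppr_le0 ler0z.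
rewrite fE addeAC subee ?add0e // ge0_fin_numE //.
by apply: integral_ge0.
Qed.

End Flow.

(** * Cheap completion of partial injections *)

Section Transport.
Local Open Scope nat_scope.

(** Integral representation of a distance of integers: the thresholds that
    separate a from b are counted. *)
Lemma sum_xor_lt (n a b : nat) : a <= n -> b <= n ->
  \sum_(i < n) ((i < a) (+) (i < b)) = `|a%:Z - b%:Z|.
Proof.
move=> an bn; rewrite -[a in RHS](minn_idPl an) -[b in RHS](minn_idPl bn).
elim: n {an bn} => [|n IH]; first by rewrite big_ord0 !minn0 subrr.
by rewrite big_ord_recr /= IH; case: (ltnP n a) (ltnP n b) => [] na [] nb /=; lia.
Qed.

Lemma sorted_nth_lt (s : seq nat) (i t : nat) : sorted leq s -> i < size s ->
  (nth 0 s i < t) = (i < count (fun y => y < t) s).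
Proof.
elim: s i => [//|x s IH] i /= xs; have ss := path_sorted xs.
have c0 : t <= x -> count (fun y => y < t) s = 0.
  move=> tx; apply/eqP; rewrite -leqn0 leqNgt -has_count; apply/hasPn => y ys.
  rewrite -leqNgt (leq_trans tx) //.
  by have /allP/(_ y ys) := order_path_min leq_trans xs.
case: i => [|i] /= si.
  by case: (ltnP x t) => // /c0 ->.
case: (ltnP x t) => xt; first by rewrite add1n ltnS IH.
by rewrite c0 // IH // c0.
Qed.

(** The cost of the monotone matching is the L1 distance between the counting
    functions: write each distance as a count of separating thresholds and
    exchange the sums, using that for sorted lists the entries below t form an
    initial segment. *)
Lemma sorted_transport_cost (e s : seq nat) (N : nat) :
  sorted leq e -> sorted leq s -> size e = size s ->
  all (fun y => y < N) e -> all (fun y => y < N) s ->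
  \sum_(i < size e) `|(nth 0 e i)%:Z - (nth 0 s i)%:Z| =
  \sum_(t < N) `|(count (fun y => y < t) e)%:Z - (count (fun y => y < t) s)%:Z|.
Proof.
move=> se ss es eN sN.
transitivity (\sum_(i < size e) \sum_(t < N)
    ((nth 0 e i < t) (+) (nth 0 s i < t))).
  apply: eq_bigr => i _.
  have ei : nth 0 e i < N by apply: (allP eN); rewrite mem_nth.
  have si : nth 0 s i < N by apply: (allP sN); rewrite mem_nth -?es.
  rewrite (_ : `| _ | = `|(nth 0 e i).+1%:Z - (nth 0 s i).+1%:Z|); last by lia.
  rewrite -(@sum_xor_lt N) //; apply: eq_bigr => t _.
  by congr nat_of_bool; rewrite !ltnS !(ltnNge (nth _ _ _)); case: (_ <= _); case: (_ <= _).
rewrite exchange_big /=; apply: eq_bigr => t _.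
rewrite -(@sum_xor_lt (size e)) ?count_size //; last by rewrite es count_size.
apply: eq_bigr => i _.
by rewrite !sorted_nth_lt // -es.
Qed.

(** Free sources and free targets of the interval [0, l) are matched in
    increasing order. The sources and targets of g below t differ in number by
    the imbalance of its crossings of t, so the same holds for the free ones,
    and [sorted_transport_cost] applies. *)
Lemma partial_perm_completion (M l : nat) (D : {set 'I_M}) (g : 'I_M -> 'I_M) :
  (forall j, j \in D -> j < l /\ g j < l) -> {in D &, injective g} ->
  exists s : {perm 'I_M},
    [/\ forall j : 'I_M, l <= j -> s j = j, {in D, s =1 g} &
        \sum_(j < M | (j < l) && (j \notin D)) `|(s j : nat)%:Z - j%:Z| <=
        \sum_(t < M) `|#|[set j in D | g j < t <= j]%SET|%:Z -
                       #|[set j in D | j < t <= g j]%SET|%:Z| ].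
Proof.
move=> Dl gI.
pose exitp (j : 'I_M) := (j < l) && (j \notin D).
pose entp (j : 'I_M) := (j < l) && (j \notin (g @: D))%SET.
pose e := [seq j <- enum 'I_M | exitp j].
pose s := [seq j <- enum 'I_M | entp j].
have cards (p : pred nat) : count (fun j : 'I_M => p j) e + #|[set j in D | p j]%SET| =
    count (fun j : 'I_M => p j) s + #|[set j in D | p (g j)]%SET|.
  have cardg : #|[set j in D | p (g j)]%SET| = #|[set k in (g @: D)%SET | p k]%SET|.
    rewrite -(card_in_imset (f := g) (D := [set j in D | p (g j)]%SET)); last first.
      by move=> i j; rewrite !inE => /andP[iD _] /andP[jD _]; exact: gI.
    apply: eq_card => k; rewrite !inE; apply/imsetP/andP => [[j]|[/imsetP[j jD ->] pj]].
      by rewrite !inE => /andP[jD pj] ->; split=> //; exact: imset_f.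
    by exists j; rewrite ?inE ?jD.
  have cnt (q : pred 'I_M) : count (fun j : 'I_M => p j) [seq j <- enum 'I_M | q j] =
      #|[set j | q j && p j]%SET|.
    rewrite -sum1_count big_filter_cond big_enum_cond /= -sum1_card.
    by apply: eq_bigl => j; rewrite !inE.
  rewrite !cnt cardg.
  have split_l (A : {set 'I_M}) : (forall j, j \in A -> j < l) ->
      #|[set j : 'I_M | ((j < l) && (j \notin A)) && p j]%SET| + #|[set j in A | p j]%SET| =
      #|[set j : 'I_M | (j < l) && p j]%SET|.
    move=> Al; rewrite -(cardsID A [set j : 'I_M | (j < l) && p j]%SET) addnC.
    congr (_ + _); apply: eq_card => j; rewrite !inE.
      by case jA : (j \in A); rewrite ?andbF ?andbT //= Al.
    by case: (j \in A); rewrite ?andbF ?andbT.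
  rewrite !split_l // => [k /imsetP[j /Dl[_ gjl] ->] //|j /Dl[]//].
have size_es : size e = size s.
  have := cards xpredT; rewrite !count_predT.
  by move/eqP; rewrite eqn_add2r => /eqP.
have eP j : (j \in e) = exitp j by rewrite mem_filter mem_enum andbT.
have sP j : (j \in s) = entp j by rewrite mem_filter mem_enum andbT.
have ue : uniq e by rewrite filter_uniq // enum_uniq.
have us : uniq s by rewrite filter_uniq // enum_uniq.
(* The default value j of nth is never reached when j is in e, since e and s
   have the same size. *)
pose F (j : 'I_M) := if l <= j then j else if j \in D then g j else nth j s (index j e).
have Fge (j : 'I_M) : l <= j -> F j = j by rewrite /F => ->.
have FD j : j \in D -> F j = g j.
  by move=> jD; have [jl _] := Dl _ jD; rewrite /F leqNgt jl jD.
have Fe j : exitp j -> F j = nth j s (index j e).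
  by move=> /andP[jl /negbTE jD]; rewrite /F leqNgt jl jD.
have Fe_s j : exitp j -> entp (F j).
  by move=> je; rewrite Fe // -sP mem_nth // -size_es index_mem eP.
have F_inj : injective F.
  have cls (j : 'I_M) : [|| l <= j, j \in D | exitp j].
    by rewrite /exitp ltnNge; case: (l <= j); case: (j \in D).
  have FDl j : j \in D -> F j < l by move=> jD; rewrite FD //; have [] := Dl _ jD.
  have Fel j : exitp j -> F j < l by move=> /Fe_s/andP[].
  have FDg j : j \in D -> F j \in (g @: D)%SET by move=> jD; rewrite FD // imset_f.
  have Feg j : exitp j -> F j \notin (g @: D)%SET by move=> /Fe_s/andP[].
  move=> i j Fij; case/or3P: (cls i) => iC; case/or3P: (cls j) => jC.
  - by rewrite -(Fge i) // -(Fge j).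
  - by have := FDl _ jC; rewrite -Fij Fge // ltnNge iC.
  - by have := Fel _ jC; rewrite -Fij Fge // ltnNge iC.
  - by have := FDl _ iC; rewrite Fij Fge // ltnNge jC.
  - by apply: gI => //; rewrite -!FD.
  - by have := Feg _ jC; rewrite -Fij FDg.
  - by have := Fel _ iC; rewrite Fij Fge // ltnNge jC.
  - by have := Feg _ iC; rewrite Fij FDg.
  - move: Fij; rewrite !Fe // (set_nth_default i j) -?size_es ?index_mem ?eP //.
    move/eqP; rewrite nth_uniq -?size_es ?index_mem ?eP // => /eqP.
    by move=> ij; rewrite -(nth_index i (s := e) (x := i)) ?eP // ij nth_index // eP.
exists (perm F_inj); split; [by move=> j jl; rewrite permE Fge|
  by move=> j jD; rewrite permE FD|].
under eq_bigr do rewrite permE.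
have -> : \sum_(j < M | (j < l) && (j \notin D)) `|(F j : nat)%:Z - j%:Z| =
    \sum_(j <- e) `|(F j : nat)%:Z - j%:Z| by rewrite big_filter big_enum_cond.
case ee : e => [|x0 e']; first by rewrite big_nil.
rewrite -ee (big_nth x0) big_mkord.
have -> : \sum_(i < size e) `|(F (nth x0 e i) : nat)%:Z - (nth x0 e i : nat)%:Z| =
    \sum_(i < size (map val e)) `|(nth 0 (map val e) i)%:Z - (nth 0 (map val s) i)%:Z|.
  rewrite size_map; apply: eq_bigr => i _.
  rewrite !(nth_map x0) -?size_es // Fe -?eP ?mem_nth // index_uniq //.
  by rewrite (set_nth_default x0) -?size_es // distnC.
have sorted_enum (P : pred 'I_M) : sorted leq (map val [seq j <- enum 'I_M | P j]).
  rewrite sorted_map; apply: sorted_filter; first by move=> x y z; exact: leq_trans.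
  by rewrite -sorted_map val_enum_ord iota_sorted.
rewrite (@sorted_transport_cost _ _ M) ?size_map //.
- apply: leq_sum => t _; rewrite !count_map.
  have := cards (fun y => y < t).
  rewrite -(cardsID [set j | g j < t]%SET [set j in D | j < t]%SET).
  rewrite -(cardsID [set j : 'I_M | j < t]%SET [set j in D | g j < t]%SET).
  set A := #|_|; set B := #|_|; set A' := #|_|; set B' := #|_|.
  have -> : A' = A by apply: eq_card => j; rewrite !inE; case: (j \in D) => //=; rewrite andbC.
  have -> : B' = #|[set j in D | g j < t <= j]%SET|.
    by apply: eq_card => j; rewrite !inE -leqNgt; case: (j \in D) => //=; rewrite andbC.
  have -> : B = #|[set j in D | j < t <= g j]%SET|.
    by apply: eq_card => j; rewrite !inE -leqNgt; case: (j \in D) => //=; rewrite andbC.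
  have E (q : seq 'I_M) : count (preim val (fun y => y < t)) q =
    count (fun j : 'I_M => j < t) q by [].
  rewrite !E; clear; move: (count _ e) (count _ s) A #|_| #|_|; clear.
  by move=> a b c u v; lia.
- exact: sorted_enum.
- exact: sorted_enum.
- by apply/allP => _ /mapP[j _ ->] /=.
- by apply/allP => _ /mapP[j _ ->] /=.
Qed.

Definition crossings_left (M : nat) (f : {ffun 'I_M -> option 'I_M}) (t : nat) : nat :=
  \sum_(j < M) (if f j is Some k then k < t <= j else false).

Definition crossings_right (M : nat) (f : {ffun 'I_M -> option 'I_M}) (t : nat) : nat :=
  \sum_(j < M) (if f j is Some k then j < t <= k else false).

Definition partial_injection (M l : nat) (f : {ffun 'I_M -> option 'I_M}) : Prop :=
  (forall j k, f j = Some k -> j < l /\ k < l) /\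
  (forall i j k, f i = Some k -> f j = Some k -> i = j).

Definition cheap_completion (M l : nat) (f : {ffun 'I_M -> option 'I_M})
    (s : {perm 'I_M}) : Prop :=
  (forall j k, f j = Some k -> s j = k) /\
  \sum_(j < M | (j < l) && (f j == None)) `|(s j : nat)%:Z - j%:Z| <=
  \sum_(t < M) `|(crossings_left f t)%:Z - (crossings_right f t)%:Z|.

(** The completion is a function of the length and of the partial injection
    alone, so that completing along all intervals at once stays measurable and
    involves finitely many permutations. *)
Lemma exists_cheap_completion (M : nat) :
  exists c : nat -> {ffun 'I_M -> option 'I_M} -> {perm 'I_M},
    (forall l (f : {ffun 'I_M -> option 'I_M}) (j : 'I_M), l <= j -> c l f j = j) /\
    (forall l (f : {ffun 'I_M -> option 'I_M}), partial_injection l f -> cheap_completion l f (c l f)).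
Proof.
have ex (lf : nat * {ffun 'I_M -> option 'I_M}) : exists s : {perm 'I_M},
    (forall j : 'I_M, lf.1 <= j -> s j = j) /\
    (partial_injection lf.1 lf.2 -> cheap_completion lf.1 lf.2 s).
  case: lf => l f /=; have [[fl fI]|nf] := pselect (partial_injection l f); last first.
    by exists 1%g; split=> // j _; rewrite perm1.
  pose D := [set j | f j != None]%SET; pose g j := odflt j (f j).
  have fg j : j \in D -> f j = Some (g j) by rewrite inE /g; case: (f j).
  have [||s [s_id sg cost]] := @partial_perm_completion M l D g.
  - by move=> j /fg /fl.
  - by move=> i j /fg fi /fg fj e; apply: (fI i j (g i)); rewrite // fj e.
  exists s; split=> // _; split=> [j k fj|].
    have jD : j \in D by rewrite inE fj.
    by rewrite sg // /g fj.
  rewrite (eq_bigl (fun j : 'I_M => (j < l) && (j \notin D))); last first.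
    by move=> j; rewrite inE negbK.
  apply: (leq_trans cost); apply: leq_sum => t _.
  have cr (P : 'I_M -> 'I_M -> bool) : #|[set j in D | P j (g j)]%SET| =
      \sum_(j < M) (if f j is Some k then P j k else false).
    rewrite -sum1_card big_mkcond; apply: eq_bigr => j _.
    by rewrite !inE /g; case: (f j) => [k|] //=; case: (P j k).
  by rewrite (cr (fun j k => k < t <= j)) (cr (fun j k => j < t <= k)).
have [c cP] := choice ex; exists (fun l f => c (l, f)); split.
  by move=> l f; have [] := cP (l, f).
by move=> l f; have [] := cP (l, f).
Qed.

End Transport.

(** * Orbits cut into intervals *)

Section Towers.
Variables (R : realType) (d : measure_display) (X : standardBorelType R d).
Variables (mu : probability X R) (T : mpaut mu).

Local Notation "'T^' n" := (mpaut_zpow T n) (at level 8, n at level 2,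
  format "'T^' n").

Variables (B : set X) (M : nat).
Hypotheses (mB : measurable B)
  (gapB : forall x, exists2 i, (i < M)%N & B (T^ (- i%:Z) x)).

(** With [len] and [base]: x lies in position [pos x] of the interval that
    starts at [base x] and has length [len (base x)]. *)
Definition pos (x : X) : nat := odflt 0%N (first_visit T backward B x).

Definition len (x : X) : nat :=
  (odflt 0%N (first_visit T (fun j => j.+1%:Z) B x)).+1.

Definition base (x : X) : X := T^ (- (pos x)%:Z) x.

Lemma posP x : first_visit_at T backward B (pos x) x.
Proof.
have [i _ /(@first_visit_ex _ _ _ _ T backward B x i)[j [_ E]]] := gapB x.
by rewrite /pos E; apply/first_visitE.
Qed.

Lemma pos_lt x : (pos x < M)%N.
Proof.
have [i iM /(@first_visit_ex _ _ _ _ T backward B x i)[j [ji E]]] := gapB x.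
by rewrite /pos E /=; exact: leq_ltn_trans iM.
Qed.

Let forward_visit x : exists j, (j < M)%N /\
  first_visit T (fun j => j.+1%:Z) B x = Some j.
Proof.
have [i iM Bi] := gapB (T^ M x).
have [|j [ji E]] := @first_visit_ex _ _ _ _ T (fun j => j.+1%:Z) B x (M - i.+1)%N.
  move: Bi; rewrite -mpaut_zpowD; rewrite (_ : - i%:Z + M%:Z = (M - i.+1).+1%:Z) //.
  lia.
by exists j; split => //; lia.
Qed.

Lemma len_le x : (len x <= M)%N.
Proof. by rewrite /len; have [j [jM ->]] := forward_visit x. Qed.

Lemma lenP x : B (T^ (len x) x).
Proof.
by rewrite /len; have [j [_ E]] := forward_visit x; rewrite E; have /first_visitE[] := E.
Qed.

Lemma len_min x (i : nat) : (0 < i)%N -> B (T^ i x) -> (len x <= i)%N.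
Proof.
case: i => [//|i] _ /(@first_visit_ex _ _ _ _ T (fun j => j.+1%:Z) B x i)[j [ji E]].
by rewrite /len E.
Qed.

Lemma base_in x : B (base x).
Proof. by have [] := posP x. Qed.

Lemma zpow_pos x : T^ (pos x) (base x) = x.
Proof. exact: zpowNK. Qed.

Lemma pos_lt_len x : (pos x < len (base x))%N.
Proof.
rewrite ltnNge; apply/negP => h; have [_ /(_ (pos x - len (base x))%N)] := posP x.
have l0 : (0 < len (base x))%N by [].
apply; first by lia.
have := lenP (base x); rewrite [in X in B X -> _]/base -mpaut_zpowD.
by rewrite (_ : (len (base x))%:Z - (pos x)%:Z = - (pos x - len (base x))%N%:Z) //; lia.
Qed.

Lemma pos_zpow x (j : nat) : B x -> (j < len x)%N -> pos (T^ j x) = j.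
Proof.
move=> Bx jl; apply: (@first_visit_at_inj _ _ _ _ T backward B _ _ (T^ j x)).
  exact: posP.
split; first by rewrite zpowK.
move=> i ij; rewrite -mpaut_zpowD (_ : _ + _ = (j - i)%N%:Z) /backward; last by lia.
by move=> /len_min -/(_ _); lia.
Qed.

Lemma base_zpow x (j : nat) : B x -> (j < len x)%N -> base (T^ j x) = x.
Proof. by move=> Bx jl; rewrite /base pos_zpow // zpowK. Qed.

Lemma pos_le_backward x (i : nat) : B (T^ (- i%:Z) x) -> (pos x <= i)%N.
Proof.
move=> Bi; have [_ npos] := posP x; rewrite leqNgt; apply/negP => /npos; exact.
Qed.

Lemma len_base_le_forward x (i : nat) : (0 < i)%N -> B (T^ i x) ->
  (len (base x) <= pos x + i)%N.
Proof.
move=> i0 Bi; apply: len_min; first by rewrite addn_gt0 i0 orbT.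
by rewrite PoszD addrC mpaut_zpowD zpow_pos.
Qed.

Lemma level_measurable_pos : level_measurable pos.
Proof.
exact: (level_measurable_comp (odflt 0%N)
  (@level_measurable_first_visit _ _ _ _ T backward B mB)).
Qed.

Lemma level_measurable_len : level_measurable len.
Proof.
exact: (level_measurable_comp (fun o => (odflt 0%N o).+1)
  (@level_measurable_first_visit _ _ _ _ T (fun j => j.+1%:Z) B mB)).
Qed.

Lemma level_measurable_base (D : Type) (f : X -> D) :
  level_measurable f -> level_measurable (fun x => f (base x)).
Proof.
move=> mf; apply: (@level_measurable_zpow_var _ _ _ _ T D f (fun x => - (pos x)%:Z)) => //.
exact: (level_measurable_comp (fun n : nat => - n%:Z) level_measurable_pos).
Qed.

Lemma measurable_tower_sum (F : X -> \bar R) : measurable_fun setT F ->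
  measurable_fun setT (fun x =>
    \sum_(j < M) (if `[< B x >] && (j < len x)%N then F (T^ j x) else 0))%E.
Proof.
move=> mF; apply: emeasurable_sum => j; apply: measurable_fun_if => //.
- exact: (level_measurable_fun (fun v : bool * nat => v.1 && (j < v.2)%N)
    (level_measurable_pair (level_measurable_asbool mB) level_measurable_len)).
- apply: measurable_funTS; apply: measurableT_comp => //.
  exact: measurable_zpow.
Qed.

(** Invariance of mu moves the contribution of the point in position j of an
    interval to the base of that interval. *)
Lemma tower_integral (F : X -> \bar R) : (forall x, (0 <= F x)%E) ->
  measurable_fun setT F ->
  (\int[mu]_x F x = \int[mu]_x
    \sum_(j < M) (if `[< B x >] && (j < len x)%N then F (T^ j x) else 0))%E.
Proof.
move=> F0 mF.
pose G (j : nat) x := (if pos x == j then F x else 0)%E.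
have mG j : measurable_fun setT (G j).
  apply: measurable_fun_if => //.
  - exact: (level_measurable_fun (fun n => n == j) level_measurable_pos).
  - exact: measurable_funTS.
have G0 j x : (0 <= G j x)%E by rewrite /G; case: ifP.
have -> : (\int[mu]_x F x = \int[mu]_x \sum_(j < M) G j x)%E.
  apply: eq_integral => x _.
  rewrite (bigD1 (Ordinal (pos_lt x))) //= big1 ?adde0 /G ?eqxx // => j.
  by rewrite -val_eqE /= eq_sym => /negbTE ->.
rewrite ge0_integral_sum // [RHS](_ : _ = \sum_(j < M) \int[mu]_x G j (T^ j x))%E.
  apply: eq_bigr => j _.
  by rewrite (@ge0_integral_mpaut _ _ _ mu (zpow_mpaut T j) (G j)).
have E (j : nat) x : G j (T^ j x) =
    (if `[< B x >] && (j < len x)%N then F (T^ j x) else 0)%E.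
  rewrite /G; case: ifP => [/eqP pj|/eqP pj].
    have bx : base (T^ j x) = x by rewrite /base pj zpowK.
    rewrite ifT //; apply/andP; split; first by apply/asboolP; rewrite -bx; exact: base_in.
    by rewrite -[in ltnLHS]pj -{2}bx pos_lt_len.
  rewrite ifF //; apply/negP => /andP[/asboolP Bx jl]; apply: pj.
  exact: pos_zpow.
rewrite -ge0_integral_sum //.
- by apply: eq_integral => x _; apply: eq_bigr => j _; rewrite E.
- move=> j; apply: measurableT_comp; first exact: mG.
  exact: measurable_zpow.
Qed.

Section IntervalPermutations.
Variables (Q : finType) (q : X -> Q) (lq : Q -> nat).
Hypotheses (mq : level_measurable q) (lenE : forall x, len x = lq (q x)).

Definition inside (phi : {ffun Q -> {perm 'I_M}}) : bool :=
  [forall p, forall j : 'I_M, (lq p <= j)%N ==> (phi p j == j)].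

Lemma insideP (phi : {ffun Q -> {perm 'I_M}}) :
  reflect (forall p (j : 'I_M), (lq p <= j)%N -> phi p j = j) (inside phi).
Proof.
apply: (iffP forallP) => [h p j pj|h p].
  by have /forallP/(_ j)/implyP/(_ pj)/eqP := h p.
by apply/forallP => j; apply/implyP => pj; apply/eqP/h.
Qed.

Lemma inside_lt (phi : {ffun Q -> {perm 'I_M}}) p (j : 'I_M) :
  inside phi -> (j < lq p)%N -> (phi p j < lq p)%N.
Proof.
move=> /insideP h jp; rewrite ltnNge; apply/negP => /[dup] pj /h /perm_inj e.
by move: jp; rewrite -e ltnNge pj.
Qed.

(** One permutation for each pattern p in the finite type Q. This is a finite
    group under the pointwise product. *)
Definition interval_perm := {phi | inside phi}.

Lemma inside_mul (phi psi : interval_perm) :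
  inside [ffun p => (val psi p * val phi p)%g].
Proof.
apply/insideP => p j pj; rewrite ffunE permM.
by rewrite (insideP _ (valP psi)) // (insideP _ (valP phi)).
Qed.

Definition interval_perm_mul (phi psi : interval_perm) : interval_perm :=
  Sub _ (inside_mul phi psi).

Lemma interval_perm_mul_inj phi : injective (interval_perm_mul phi).
Proof.
move=> psi psi' /(congr1 val) /ffunP e; apply: val_inj; apply/ffunP => p.
by have := e p; rewrite !ffunE => /mulIg.
Qed.

Lemma inside_inv (phi : interval_perm) : inside [ffun p => (val phi p)^-1%g].
Proof.
apply/insideP => p j pj; rewrite ffunE; apply: (@perm_inj _ (val phi p)).
by rewrite permKV (insideP _ (valP phi)).
Qed.

Definition interval_perm_inv (phi : interval_perm) : interval_perm :=
  Sub _ (inside_inv phi).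

Lemma inside_one : inside [ffun=> 1%g].
Proof. by apply/insideP => p j _; rewrite ffunE perm1. Qed.

Definition interval_perm_one : interval_perm := Sub _ inside_one.

Definition posO x : 'I_M := Ordinal (pos_lt x).

(** The cocycle of the transformation that permutes every interval by the
    permutation attached to the pattern of the interval. *)
Definition displacement (phi : interval_perm) (x : X) : int :=
  (val phi (q (base x)) (posO x) : nat)%:Z - (pos x)%:Z.

Definition permute (phi : interval_perm) (x : X) : X := T^ (displacement phi x) x.

Lemma permuteE phi x : permute phi x = T^ (val phi (q (base x)) (posO x)) (base x).
Proof. by rewrite /permute /displacement mpaut_zpowD. Qed.

Let image_lt (phi : interval_perm) x : (val phi (q (base x)) (posO x) < len (base x))%N.
Proof. by rewrite lenE inside_lt // ?(valP phi) //= -lenE pos_lt_len. Qed.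

Lemma pos_permute phi x : pos (permute phi x) = val phi (q (base x)) (posO x).
Proof. by rewrite permuteE pos_zpow //; exact: base_in. Qed.

Lemma base_permute phi x : base (permute phi x) = base x.
Proof. by rewrite permuteE base_zpow //; exact: base_in. Qed.

Lemma posO_permute phi x : posO (permute phi x) = val phi (q (base x)) (posO x).
Proof. by apply: val_inj; rewrite /= pos_permute. Qed.

(** A point keeps its base, hence its pattern, under [permute], so the cocycle
    identity holds at every point. *)
Lemma displacement_mul phi psi x : displacement (interval_perm_mul phi psi) x =
  displacement phi (permute psi x) + displacement psi x.
Proof.
rewrite /displacement base_permute posO_permute pos_permute SubK ffunE permM.
by rewrite addrA subrK.
Qed.

Lemma permute_mul phi psi x :
  permute (interval_perm_mul phi psi) x = permute phi (permute psi x).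
Proof. by rewrite {1}/permute displacement_mul mpaut_zpowD. Qed.

Lemma permute_one x : permute interval_perm_one x = x.
Proof.
by rewrite /permute /displacement SubK ffunE perm1 subrr.
Qed.

Lemma permute_bij phi : bijective (permute phi).
Proof.
exists (permute (interval_perm_inv phi)) => x.
  rewrite -permute_mul -[RHS]permute_one; congr (permute _ x).
  by apply: val_inj; apply/ffunP => p; rewrite /= !ffunE mulgV.
rewrite -permute_mul -[RHS]permute_one; congr (permute _ x).
by apply: val_inj; apply/ffunP => p; rewrite /= !ffunE mulVg.
Qed.

Lemma level_measurable_displacement phi : level_measurable (displacement phi).
Proof.
have mposO : level_measurable posO.
  move=> v; rewrite (_ : [set x | _] = [set x | pos x = v]).
    exact: level_measurable_pos.
  by apply/seteqP; split => x /=; [move=> <-|move=> e; exact: val_inj].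
exact: (level_measurable2 (fun p (j : 'I_M) => (val phi p j : nat)%:Z - j%:Z)
  (level_measurable_base mq) mposO).
Qed.

Lemma displacement_le phi x : `|displacement phi x| <= M%:Z.
Proof.
have := ltn_ord (val phi (q (base x)) (posO x)); have := pos_lt x.
rewrite /displacement; lia.
Qed.

End IntervalPermutations.

End Towers.

(** * The cost of rerouting the points that leave their interval *)

Section Rerouting.
Variables (R : realType) (d : measure_display) (X : standardBorelType R d).
Variables (mu : probability X R) (T : mpaut mu).

Local Notation "'T^' n" := (mpaut_zpow T n) (at level 8, n at level 2,
  format "'T^' n").

Variables (B : set X) (M : nat).
Hypotheses (mB : measurable B)
  (gapB : forall x, exists2 i, (i < M)%N & B (T^ (- i%:Z) x)).

Local Notation pos := (pos T B).
Local Notation len := (len T B).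
Local Notation base := (base T B).

Section OneFunction.
Variable h : X -> int.
Hypothesis mh : level_measurable h.

Definition stays (z : X) : bool :=
  (0 <= (pos z)%:Z + h z) && ((pos z)%:Z + h z < (len (base z))%:Z).

Definition leaves (z : X) : bool := ~~ stays z.

Lemma stays_zpow x (j : nat) : B x -> (j < len x)%N -> stays (T^ j x) =
  (0 <= j%:Z + h (T^ j x)) && (j%:Z + h (T^ j x) < (len x)%:Z).
Proof. by move=> Bx jl; rewrite /stays (pos_zpow gapB) // (base_zpow gapB). Qed.

Lemma level_measurable_stays : level_measurable stays.
Proof.
exact: (level_measurable_comp
  (fun v : nat * int * nat => (0 <= v.1.1%:Z + v.1.2) && (v.1.1%:Z + v.1.2 < v.2%:Z))
  (level_measurable_pair (level_measurable_pair (level_measurable_pos T mB) mh)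
    (@level_measurable_base _ _ _ _ T B mB _ _ (level_measurable_len T mB)))).
Qed.

Lemma level_measurable_leaves : level_measurable leaves.
Proof. exact: (level_measurable_comp negb level_measurable_stays). Qed.

Definition target (x : X) (j : 'I_M) : option 'I_M :=
  if [&& (j < len x)%N, 0 <= j%:Z + h (T^ j x) & j%:Z + h (T^ j x) < (len x)%:Z]
  then insub `|(j%:Z + h (T^ j x))%R|%N else None.

Definition targets (x : X) : {ffun 'I_M -> option 'I_M} := [ffun j => target x j].

Lemma level_measurable_targets : level_measurable targets.
Proof.
apply: level_measurable_ffun => j.
exact: (level_measurable_comp (fun v : nat * int =>
   if [&& (j < v.1)%N, 0 <= j%:Z + v.2 & j%:Z + v.2 < v.1%:Z]
   then insub `|(j%:Z + v.2)%R|%N else None)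
  (level_measurable_pair (level_measurable_len T mB) (level_measurable_zpow T j mh))).
Qed.

Lemma targetP x (j k : 'I_M) : target x j = Some k <->
  (j < len x)%N /\ (k < len x)%N /\ (k : nat)%:Z = j%:Z + h (T^ j x).
Proof.
rewrite /target; split.
  case: ifP => [/and3P[jl h0 hl]|//]; case: insubP => // k' _ k'E [<-].
  have {}k'E : (k' : nat) = `|(j%:Z + h (T^ j x))%R|%N := k'E.
  by split=> //; split; lia.
move=> [jl [kl kE]]; rewrite jl -kE ltz_nat kl /=.
by rewrite (insubT (fun n => (n < M)%N) (ltn_ord k)); congr Some; exact: val_inj.
Qed.

Lemma target_None x (j : 'I_M) : B x -> (j < len x)%N ->
  (target x j == None) = leaves (T^ j x).
Proof.
move=> Bx jl; rewrite /leaves stays_zpow // /target jl /=.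
case: ifP => // /andP[h0 hl]; case: insubP => //= /negP[].
by have := len_le gapB x; lia.
Qed.

Lemma partial_injection_targets x : B x ->
  (forall m n : int, m + h (T^ m x) = n + h (T^ n x) -> m = n) ->
  partial_injection (len x) (targets x).
Proof.
move=> Bx hI; split => [j k|i j k]; rewrite !ffunE => /targetP[jl [kl kE]] //.
move=> /targetP[jl' [_ kE']]; apply/val_inj/eqP; rewrite -eqz_nat; apply/eqP.
by apply: hI; rewrite -kE -kE'.
Qed.

(** A point which stays in its interval and crosses a cut inside the interval
    that starts at x belongs to this interval, so the flow is a count of
    crossings of a partial map of positions. *)
Lemma flow_right_stays x (t : nat) : B x -> (t < len x)%N ->
  flow_right T h stays (T^ t x) = ((crossings_right (targets x) t)%:R)%:E.
Proof.
move=> Bx tl.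
have tM : (t <= M)%N by apply: leq_trans (len_le gapB x); exact: ltnW.
pose F (j : nat) : bool := stays (T^ j x) && (t%:Z <= j%:Z + h (T^ j x)).
rewrite /flow_right (@ecount_fin _ _ t) => [|n tn]; last first.
  rewrite -mpaut_zpowD (_ : _ + _ = - (n.+1 - t)%N%:Z); last by lia.
  set z := T^ _ x; apply/negP => /andP[/andP[_ zl] hz].
  have := @len_base_le_forward _ _ _ _ T B z (n.+1 - t)%N.
  by rewrite zpowNK => /(_ _ Bx); lia.
congr (_%:R)%:E; rewrite (reindex_inj rev_ord_inj).
transitivity (\sum_(j < t) F j)%N.
  apply: eq_bigr => j _; rewrite /F.
  have jt := ltn_ord j; have re : (rev_ord j : nat) = (t - j.+1)%N by [].
  rewrite re -mpaut_zpowD (_ : _ + _ = j%:Z); last by lia.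
  by congr (nat_of_bool (_ && _)); lia.
rewrite (big_ord_widen M (fun j => nat_of_bool (F j)) tM) big_mkcond; apply: eq_bigr => j _.
rewrite ffunE /target; case: (ltnP j t) => jt; last by case: ifP => // _; case: insub.
have jl : (j < len x)%N by exact: ltn_trans tl.
rewrite jl /F stays_zpow //=; case: ifP => // /andP[h0 hl] /=.
case: insubP => [k _ kE|/negP[]]; last by have := len_le gapB x; lia.
by rewrite kE; congr nat_of_bool; lia.
Qed.

Lemma flow_left_stays x (t : nat) : B x -> (t < len x)%N ->
  flow_left T h stays (T^ t x) = ((crossings_left (targets x) t)%:R)%:E.
Proof.
move=> Bx tl.
pose F (j : nat) : bool := stays (T^ j x) && (j%:Z + h (T^ j x) < t%:Z).
rewrite /flow_left (@ecount_fin _ _ (len x - t)) => [|n tn]; last first.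
  rewrite -mpaut_zpowD -PoszD; set z := T^ _ x.
  apply/negP => /andP[/andP[zl _] hz].
  have := @pos_le_backward _ _ _ _ T B M gapB z (n + t - len x)%N.
  rewrite /z -mpaut_zpowD (_ : _ + _ = (len x)%:Z); last by lia.
  by move=> /(_ (lenP gapB x)); rewrite -/z; lia.
congr (_%:R)%:E.
transitivity (\sum_(t <= j < len x) F j)%N.
  rewrite -[t in RHS]add0n big_addn big_mkord; apply: eq_bigr => n _.
  rewrite -mpaut_zpowD -PoszD /F; congr (nat_of_bool (_ && _)); lia.
rewrite (@big_nat_widenl _ _ _ _ 0%N) // (big_nat_widen 0 (len x) M) ?(len_le gapB) //.
rewrite big_mkord big_mkcond; apply: eq_bigr => j _ /=.
rewrite ffunE /target; case: (ltnP j (len x)) => jl /=; last by rewrite andbF.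
rewrite andbT; case: (leqP t j) => tj; last first.
  case: ifP => // _; case: insub => // k; rewrite andbF; lia.
rewrite /F stays_zpow //=; case: ifP => // /andP[h0 hl] /=.
case: insubP => [k _ kE|/negP[]]; last by have := len_le gapB x; lia.
by rewrite kE; congr nat_of_bool; lia.
Qed.

Lemma flow_split_right (y : X) : flow_right T h xpredT y =
  (flow_right T h stays y + flow_right T h leaves y)%E.
Proof.
by apply: ecountD => n; rewrite /leaves; case: (stays _); rewrite //= addn0.
Qed.

Lemma flow_split_left (y : X) : flow_left T h xpredT y =
  (flow_left T h stays y + flow_left T h leaves y)%E.
Proof.
by apply: ecountD => n; rewrite /leaves; case: (stays _); rewrite //= addn0.
Qed.

(** Since the full flow is balanced, the imbalance of the flow of the staying
    points is opposite to that of the leaving points. *)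
Lemma crossings_le_flow x (t : nat) : B x -> (t < len x)%N ->
  flow_left T h xpredT (T^ t x) \is a fin_num ->
  flow_right T h xpredT (T^ t x) = flow_left T h xpredT (T^ t x) ->
  ((`|((crossings_left (targets x) t)%:Z - (crossings_right (targets x) t)%:Z)%R|%N%:R)%:E
    <= flow_right T h leaves (T^ t x) + flow_left T h leaves (T^ t x))%E.
Proof.
move=> Bx tl; rewrite flow_split_right flow_split_left flow_right_stays //.
rewrite flow_left_stays //; set L := crossings_left _ _; set Rr := crossings_right _ _.
have := ecount_ge0 R (fun n => leaves (T^ n (T^ t x)) && (h (T^ n (T^ t x)) < - n%:Z)).
have := ecount_ge0 R (fun n => leaves (T^ (- n.+1%:Z) (T^ t x)) && (n.+1%:Z <= h (T^ (- n.+1%:Z) (T^ t x)))).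
rewrite -/(flow_left T h leaves (T^ t x)) -/(flow_right T h leaves (T^ t x)).
case: (flow_left _ _ _ _) => [l||] //; case: (flow_right _ _ _ _) => [r||] //.
rewrite !lee_fin => r0 l0 _; rewrite -!EFinD => -[e].
have [LR|/ltnW LR] := leqP L Rr.
  rewrite (_ : `|(L%:Z - Rr%:Z)%R|%N = (Rr - L)%N) ?natrB //; last by lia.
  by move: e; lra.
rewrite (_ : `|(L%:Z - Rr%:Z)%R|%N = (L - Rr)%N) ?natrB //; last by lia.
by move: e; lra.
Qed.

Definition excess (x : X) : \bar R := ((if leaves x then `|h x|%N else 0)%N%:R)%:E.

Lemma integral_flow_leaves :
  (\int[mu]_x (flow_right T h leaves x + flow_left T h leaves x) =
   \int[mu]_x excess x)%E.
Proof.
have ml := level_measurable_leaves.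
rewrite ge0_integralD //; last 4 first.
- by move=> x _; exact: ecount_ge0.
- exact: measurable_flow_right.
- by move=> x _; exact: ecount_ge0.
- exact: measurable_flow_left.
rewrite integral_flow_right // integral_flow_left //.
have mk (Q : bool -> int -> nat) : measurable_fun setT (fun x => ((Q (leaves x) (h x))%:R : R)%:E).
  exact: (level_measurable_fun (fun v : bool * int => ((Q v.1 v.2)%:R : R)%:E)
    (level_measurable_pair ml mh)).
rewrite -ge0_integralD //; last 4 first.
- by move=> x _; rewrite lee_fin.
- exact: (mk (fun b n => if b && (0 < n) then `|n|%N else 0%N)).
- by move=> x _; rewrite lee_fin.
- exact: (mk (fun b n => if b && (n < 0) then `|n|%N else 0%N)).
apply: eq_integral => x _; rewrite /excess -EFinD -natrD; congr (_%:R)%:E.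
by case: (leaves x) => //=; case: (ltgtP (h x) 0) => h0; rewrite ?h0 ?addn0 ?add0n.
Qed.

Section Cost.
Variables (Q : finType) (q : X -> Q) (lq : Q -> nat) (w : interval_perm M lq).
Hypotheses (mq : level_measurable q) (lenE : forall x, len x = lq (q x)).
Hypothesis w_completes : forall x, partial_injection (len x) (targets x) ->
  cheap_completion (len x) (targets x) (val w (q x)).
Hypothesis h_bij : orbit_bijective T h.
Hypothesis h_balanced : \forall y \ae mu,
  flow_left T h xpredT y \is a fin_num /\
  flow_right T h xpredT y = flow_left T h xpredT y.

Local Notation displ := (displacement gapB q w).

Let completed : \forall z \ae mu, partial_injection (len (base z)) (targets (base z)).
Proof.
apply: filterS (ae_orbit T h_bij) => z hz.
apply: partial_injection_targets; first exact: base_in.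
by have [] := hz (- (pos z)%:Z).
Qed.

Let displ_stays : \forall z \ae mu, stays z -> displ z = h z.
Proof.
apply: filterS completed => z /w_completes[wE _] sz.
have pl := pos_lt_len gapB z.
pose k := `|((pos z)%:Z + h z)%R|%N.
have [k0 kl] := andP sz.
have kM : (k < M)%N by have := len_le gapB (base z); rewrite /k; lia.
have tk : targets (base z) (posO gapB z) = Some (Ordinal kM).
  have pz : (posO gapB z : nat) = pos z by [].
  by rewrite ffunE; apply/targetP; rewrite pz zpow_pos /=; split=> //; split; lia.
by rewrite /displacement (wE _ _ tk) /= /k; lia.
Qed.

Let mcost : level_measurable displ.
Proof. exact: level_measurable_displacement. Qed.

Let mE (f : bool -> int -> int -> nat) :
  measurable_fun setT (fun x => ((f (leaves x) (h x) (displ x))%:R : R)%:E).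
Proof.
exact: (level_measurable_fun (fun v : bool * int * int => ((f v.1.1 v.1.2 v.2)%:R : R)%:E)
  (level_measurable_pair (level_measurable_pair level_measurable_leaves mh) mcost)).
Qed.

(** Summed over the positions of one interval, the cost of the rerouted points
    is at most the imbalance of crossings, hence at most the flow of leaving
    points. Integrating over the bases and unfolding the towers on both sides
    gives the claim. *)
Let rerouting_cost :
  (\int[mu]_x ((if leaves x then `|displ x|%N else 0)%N%:R)%:E <=
   \int[mu]_x excess x)%E.
Proof.
have mfr := measurable_flow_right T mh level_measurable_leaves.
have mfl := measurable_flow_left T mh level_measurable_leaves.
rewrite -integral_flow_leaves (tower_integral mB gapB); last 2 first.
- by move=> x; rewrite lee_fin.
- exact: (mE (fun b n m => if b then `|m|%N else 0%N)).
rewrite [leRHS](tower_integral mB gapB); last 2 first.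
- by move=> x; rewrite adde_ge0 // ecount_ge0.
- exact: emeasurable_funD.
apply: ae_ge0_le_integral => //.
- by move=> x _; apply: sume_ge0 => j _; case: ifP => // _; rewrite lee_fin.
- exact: (@measurable_tower_sum _ _ _ _ T B M mB
    (fun x => ((if leaves x then `|displ x|%N else 0)%N%:R)%:E)
    (mE (fun b n m => if b then `|m|%N else 0%N))).
- by move=> x _; apply: sume_ge0 => j _; case: ifP => // _; rewrite adde_ge0 // ecount_ge0.
- exact: (@measurable_tower_sum _ _ _ _ T B M mB
    (fun x => flow_right T h leaves x + flow_left T h leaves x)%E
    (emeasurable_funD mfr mfl)).
apply: filterS2 (ae_orbit T h_bij) (ae_orbit T h_balanced) => x hx flx _.
have [Bx|nBx] := asboolP (B x); last by rewrite !big1.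
have [hI _] := hx 0.
have [wE wcost] := w_completes (partial_injection_targets Bx hI).
apply: (@le_trans _ _ ((\sum_(j < M | (j < len x)%N && (targets x j == None))
    `|((val w (q x) j : nat)%:Z - j%:Z)%R|)%N%:R)%:E).
  rewrite natr_sum -sumEFin [leRHS]big_mkcond; apply: lee_sum => j _.
  rewrite andTb ffunE; case: ifP => // jl; rewrite target_None // /leaves.
  case: ifP => // _; rewrite lee_fin ler_nat /displacement.
  have -> : posO gapB (T^ j x) = j by apply: val_inj; rewrite /= (pos_zpow gapB).
  by rewrite (pos_zpow gapB) // (base_zpow gapB).
apply: (@le_trans _ _ ((\sum_(t < M)
    `|((crossings_left (targets x) t)%:Z - (crossings_right (targets x) t)%:Z)%R|)%N%:R)%:E).
  by rewrite lee_fin ler_nat.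
rewrite natr_sum -sumEFin; apply: lee_sum => t _.
rewrite andTb; case: ltnP => tl.
  by have [? ?] := flx t; exact: crossings_le_flow.
rewrite /crossings_left /crossings_right !big1 ?subrr // => j _; rewrite ffunE.
  by case E : (target x j) => [k|//]; have /targetP := E; lia.
by case E : (target x j) => [k|//]; have /targetP := E; lia.
Qed.

(** At staying points there is no error; at leaving points the error is at
    most |h| plus the rerouting displacement, and each has integral at most
    that of the excess. *)
Lemma displacement_cost :
  (\int[mu]_x (`|h x - displ x|%:~R)%:E <=
   \int[mu]_x excess x + \int[mu]_x excess x)%E.
Proof.
apply: (@le_trans _ _ (\int[mu]_x (excess x +
    ((if leaves x then `|displ x|%N else 0)%N%:R)%:E))%E).
  apply: ae_ge0_le_integral => //.
  - exact: (level_measurable_fun (fun n : int => (`|n|%:~R : R)%:E)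
      (level_measurable2 (fun a b : int => a - b) mh mcost)).
  - by move=> x _; rewrite adde_ge0 // lee_fin.
  - apply: emeasurable_funD.
      exact: (mE (fun b n m => if b then `|n|%N else 0%N)).
    exact: (mE (fun b n m => if b then `|m|%N else 0%N)).
  - apply: filterS displ_stays => x; rewrite /excess /leaves => sx _.
    rewrite -EFinD lee_fin -natrD pmulrn ler_int.
    by case: (stays x) sx => [->//|_]; [rewrite subrr|rewrite /=; lia].
rewrite ge0_integralD //; last 4 first.
- by move=> x _; rewrite lee_fin.
- exact: (mE (fun b n m => if b then `|n|%N else 0%N)).
- by move=> x _; rewrite lee_fin.
- exact: (mE (fun b n m => if b then `|m|%N else 0%N)).
by apply: leeD2l; exact: rerouting_cost.
Qed.

End Cost.

End OneFunction.

End Rerouting.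

(** * Finite groups approximating balanced cocycles *)

Section Approximation.
Variables (R : realType) (d : measure_display) (X : standardBorelType R d).
Variables (mu : probability X R) (T : mpaut mu).
Hypotheses (mu_nonatomic : nonatomic mu) (T_ergodic : ergodic T).

Local Notation "'T^' n" := (mpaut_zpow T n) (at level 8, n at level 2,
  format "'T^' n").

Definition tail (h : X -> int) (K : nat) (x : X) : \bar R :=
  ((if (K < `|h x|)%N then `|h x|%N else 0)%N%:R)%:E.

Lemma measurable_tail h K : level_measurable h -> measurable_fun setT (tail h K).
Proof.
exact: (level_measurable_fun
  (fun n : int => ((if (K < `|n|)%N then `|n|%N else 0)%N%:R : R)%:E)).
Qed.

Lemma integral_tail_small (h : X -> int) (e : R) : level_measurable h ->
  (\int[mu]_x (`|h x|%:~R : R)%:E < +oo)%E -> 0 < e ->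
  exists K, forall K', (K <= K')%N -> (\int[mu]_x tail h K' x < e%:E)%E.
Proof.
move=> mh hoo e0.
have mg : measurable_fun setT (fun x => (`|h x|%:~R : R)%:E).
  exact: (level_measurable_fun (fun n : int => (`|n|%:~R : R)%:E) mh).
have ig : mu.-integrable setT (fun x => (`|h x|%:~R : R)%:E).
  by apply/integrableP; split=> //; under eq_integral do rewrite gee0_abs ?lee_fin ?ler0z //.
have tail_le K x : (`|tail h K x| <= (`|h x|%:~R : R)%:E)%E.
  by rewrite gee0_abs ?lee_fin // pmulrn ler_int; case: ifP => //; lia.
have tail_cvg x : tail h ^~ x @ \oo --> 0%E.
  apply: cvg_near_cst; exists `|h x|%N => // K /= hK.
  by rewrite /tail ltnNge hK.
have [_ _ cv] := @dominated_convergence _ _ _ mu setT measurableT (tail h) (cst 0%E) _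
  (fun n => measurable_tail n mh) (measurable_cst _) (aeW _ (fun x _ => tail_cvg x)) ig
  (aeW _ (fun x K _ => tail_le K x)).
move: cv; rewrite integral0 => cv.
have /cv[K _ KP] : nbhs 0%E [set y : \bar R | (y < e%:E)%E].
  by apply: open_nbhs_nbhs; split; [exact: open_ereal_lt_ereal|rewrite /= lte_fin].
by exists K => K' /KP.
Qed.

(** A point with |h x| <= K that leaves its interval is within distance K of a
    cut, and at most 2 K + 1 translates of B contain all such points. *)
Lemma excess_le_tail (B : set X) (M : nat) (gapB : forall x, exists2 i, (i < M)%N & B (T^ (- i%:Z) x))
    (h : X -> int) (K : nat) : measurable B -> level_measurable h ->
  (\int[mu]_x excess T B h x <=
   \int[mu]_x tail h K x + (K * K.*2.+1)%N%:R%:E * mu B)%E.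
Proof.
move=> mB mh.
pose C := \bigcup_(i < K.*2.+1) T^ (i%:Z - K%:Z) @^-1` B.
have mC : measurable C.
  by apply: fin_bigcup_measurable => // i _; exact: measurable_zpow_preimage.
have muC : (mu C <= (K.*2.+1)%:R%:E * mu B)%E.
  rewrite /C bigcup_mkord; apply: le_trans.
    apply: (@Boole_inequality _ _ _ mu (fun i => T^ (i%:Z - K%:Z) @^-1` B)) => i _.
    exact: measurable_zpow_preimage.
  rewrite (eq_bigr (fun=> mu B)) => [|i _]; last exact: zpow_preserving.
  by rewrite -(fineK (fin_num_measure mu B mB)) sumEFin sumr_const card_ord -EFinM mulr_natl.
have m1C : measurable_fun setT (fun x => (\1_C x)%:E : \bar R).
  by apply/measurable_EFinP; exact: measurable_indic.
have indicC x : leaves T B h x -> (`|h x| <= K)%N -> C x.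
  rewrite /leaves /stays negb_and -!ltNge -leNgt => lx hK.
  have pl := pos_lt_len gapB x; have [hlt|hge] := orP lx.
        (* The point leaves to the left, so its base is within distance K. *)
exists (K - pos T B x)%N; first by rewrite /=; lia.
    rewrite /= (_ : _ - _ = - (pos T B x)%:Z); last by lia.
    exact: (base_in gapB).
    (* The point leaves to the right, so the next cut is within distance K. *)
exists (K + (len T B (base T B x) - pos T B x))%N; first by rewrite /=; lia.
  have := lenP gapB (base T B x).
  rewrite [X in T^ _ X]/base -mpaut_zpowD => Bl.
  by rewrite /= (_ : _ - K%:Z = (len T B (base T B x))%:Z - (pos T B x)%:Z) //; lia.
apply: (@le_trans _ _ (\int[mu]_x (tail h K x + (K%:R)%:E * (\1_C x)%:E))%E).
  apply: ge0_le_integral => //.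
  - by move=> x _; rewrite lee_fin.
  - exact: (level_measurable_fun (fun v : bool * int => ((if v.1 then `|v.2|%N else 0)%N%:R : R)%:E)
      (level_measurable_pair (level_measurable_leaves T mB mh) mh)).
  - apply: emeasurable_funD; first exact: measurable_tail.
    exact: measurable_funeM m1C.
  - move=> x _; rewrite /excess /tail -EFinM -EFinD lee_fin.
    case lx: (leaves T B h x); last by rewrite addr_ge0 // mulr_ge0.
    case: ltnP => hK; first by rewrite lerDl mulr_ge0.
    by rewrite indicE mem_set ?mulr1 ?add0r ?ler_nat //; exact: indicC.
rewrite ge0_integralD //; last 3 first.
- by move=> x _; rewrite lee_fin.
- exact: measurable_tail.
- exact: measurable_funeM m1C.
rewrite ge0_integralZl_EFin // ?integral_indic // setIT leeD2l //.
rewrite natrM EFinM -muleA; exact: lee_wpmul2l.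
Qed.

(** The pattern of an interval records its length and the partial maps induced
    by all h i, which leaves finitely many patterns; a single finite group
    then contains approximants of all the h i. *)
Lemma finite_group_approximation (I : finType) (h : I -> X -> int) (e : R) :
  0 < e -> (forall i, level_measurable (h i)) ->
  (forall i, orbit_bijective T (h i)) ->
  (forall i, (\int[mu]_x (`|h i x|%:~R : R)%:E < +oo)%E) ->
  (forall i, (\int[mu]_x ((h i x)%:~R : R)%:E = 0)%E) ->
  exists (J : finType) (mul : J -> J -> J) (a : J -> X -> int) (w : I -> J) (M : nat),
    [/\ (0 < #|J|)%N, forall phi, injective (mul phi),
        forall phi, [/\ level_measurable (a phi), forall x, `|a phi x| <= M%:Z &
          bijective (fun x => T^ (a phi x) x)],
        forall phi psi x, a (mul phi psi) x = a phi (T^ (a psi x) x) + a psi x &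
        forall i, (\int[mu]_x (`|h i x - a (w i) x|%:~R : R)%:E < e%:E)%E].
Proof.
move=> e0 mh hbij hint h0.
have e4 : 0 < e / 4 by rewrite divr_gt0.
have [Kf KfP] := choice (fun i => integral_tail_small (mh i) (hint i) e4).
pose K := (\max_i Kf i)%N.
have KP i : (\int[mu]_x tail (h i) K x < (e / 4)%:E)%E.
  by apply: KfP; exact: leq_bigmax.
pose c : R := (K * K.*2.+1)%N%:R.
have c0 : 0 <= c by rewrite ler0n.
(* With mu B below this bound, c * mu B is at most e / 4, also when c is 0. *)
have dl : 0 < e / 4 / (c + 1) by rewrite divr_gt0 // ltr_wpDl.
have [B [M [mB Bsmall gapB]]] := exists_cut_set mu_nonatomic T_ergodic dl.
have excess_small i : (\int[mu]_x excess T B (h i) x < (e / 2)%:E)%E.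
  apply: le_lt_trans (excess_le_tail gapB K mB (mh i)) _.
  rewrite (_ : e / 2 = e / 4 + e / 4); last by lra.
  rewrite EFinD; apply: lte_leD => //.
    by rewrite fin_numM // fin_num_measure.
  move: Bsmall; rewrite -(fineK (fin_num_measure mu B mB)) lte_fin -EFinM lee_fin => Bs.
  apply: (@le_trans _ _ ((c + 1) * (e / 4 / (c + 1)))).
    apply: ler_pM; [exact: c0|exact: fine_ge0|by rewrite [c + 1]addrC lerDr|exact: ltW].
  by rewrite mulrC divfK // gt_eqF // ltr_wpDl.
(* Lengths are at most M, hence the bound M.+1. *)
pose Q := ('I_M.+1 * {ffun I -> {ffun 'I_M -> option 'I_M}})%type.
pose lq (p : Q) : nat := p.1.
pose q (x : X) : Q := (inord (len T B x), [ffun i => targets T B M (h i) x]).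
have lenE x : len T B x = lq (q x).
  by rewrite /lq /= inordK // ltnS (len_le gapB).
have mq : level_measurable q.
  apply: level_measurable_pair.
    exact: (level_measurable_comp (inord : nat -> 'I_M.+1) (level_measurable_len T mB)).
  by apply: level_measurable_ffun => i; exact: level_measurable_targets.
have [cp [cp_id cp_ok]] := exists_cheap_completion M.
have w_in i : inside lq [ffun p : Q => cp (lq p) (p.2 i)].
  by apply/insideP => p j pj; rewrite ffunE cp_id.
pose w i : interval_perm M lq := Sub _ (w_in i).
exists (interval_perm M lq), (@interval_perm_mul M Q lq), (@displacement _ _ _ _ T B M gapB Q q lq), w, M.
split.
- by apply/card_gt0P; exists (interval_perm_one M lq).
- exact: interval_perm_mul_inj.
- move=> phi; split.
  + exact: level_measurable_displacement.
  + exact: displacement_le.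
  + exact: permute_bij.
- by move=> phi psi x; rewrite displacement_mul.
- move=> i; have [k [flow intk]] := constant_flow T_ergodic (mh i) (hbij i) (hint i).
  move: intk; rewrite h0 => -[/esym/eqP]; rewrite intr_eq0 => /eqP k0.
  apply: le_lt_trans (displacement_cost mB gapB (mh i) (w := w i) mq _ (hbij i) _) _.
  + by move=> x /cp_ok; rewrite /w SubK ffunE -lenE /q /= ffunE.
  + by apply: filterS flow => y [? ->]; rewrite k0 adde0.
  + by rewrite [e]splitr EFinD lteD.
Qed.

End Approximation.

(** * The Folner condition for the L1 full group *)

Section Folner.
Variables (R : realType) (d : measure_display) (X : standardBorelType R d).
Variables (mu : probability X R) (T : mpaut mu).
Hypotheses (mu_nonatomic : nonatomic mu) (T_ergodic : ergodic T).

Local Notation "'T^' n" := (mpaut_zpow T n) (at level 8, n at level 2,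
  format "'T^' n").
Local Notation G := (L1_full_group T).

Lemma level_measurable_mpaut (D : Type) (f : X -> D) (V : mpaut mu) :
  level_measurable f -> level_measurable (fun x => f (V x)).
Proof.
by move=> mf v; have := measurable_mpaut V measurableT (mf v); rewrite setTI.
Qed.

Lemma measurable_norm_int (h : X -> int) : level_measurable h ->
  measurable_fun setT (fun x => (`|h x|%:~R : R)%:E).
Proof. exact: (level_measurable_fun (fun n : int => (`|n|%:~R : R)%:E)). Qed.

Lemma integral_norm_mpaut (h : X -> int) (V : mpaut mu) : level_measurable h ->
  (\int[mu]_x (`|h (V x)|%:~R : R)%:E = \int[mu]_x (`|h x|%:~R : R)%:E)%E.
Proof.
move=> mh; rewrite (@ge0_integral_mpaut _ _ _ mu V (fun y => (`|h y|%:~R)%:E)) //.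
exact: measurable_norm_int.
Qed.

Lemma integral_mpaut (h : X -> int) (V : mpaut mu) : level_measurable h ->
  (\int[mu]_x ((h (V x))%:~R : R)%:E = \int[mu]_x ((h x)%:~R : R)%:E)%E.
Proof.
move=> mh.
have mf : measurable_fun setT (fun x => ((h x)%:~R : R)%:E).
  exact: (level_measurable_fun (fun n : int => (n%:~R : R)%:E)).
rewrite integralE [RHS]integralE -/((fun x => ((h x)%:~R : R)%:E) \o V).
rewrite funepos_comp funeneg_comp !ge0_integral_mpaut //.
- exact: measurable_funeneg.
- exact: measurable_funepos.
Qed.

(** The difference of the cocycles of u w and v w is that of u and v, composed
    with the measure-preserving action of w. *)
Lemma mdist_mulr (u v w : G) : mdist (u * w)%g (v * w)%g = mdist u v.
Proof.
apply: EFin_inj.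
pose D x := cocycle_of u x - cocycle_of v x.
have mD : level_measurable D.
  exact: (level_measurable2 (fun a b : int => a - b)
    (level_measurable_cocycle_of u) (level_measurable_cocycle_of v)).
rewrite (@mdist_ae_eq _ _ _ _ T (u * w)%g (v * w)%g (fun x => D (action_of w x))).
- by rewrite (@mdist_ae_eq _ _ _ _ T u v D) ?integral_norm_mpaut //; exact: aeW.
- exact: level_measurable_mpaut.
- apply: filterS2 (cocycle_ofM mu_nonatomic T_ergodic u w)
    (cocycle_ofM mu_nonatomic T_ergodic v w) => x -> ->.
  by rewrite /D; lia.
Qed.

Lemma mdist_divg (u v : G) : mdist (1%g : G) (u * v^-1)%g = mdist v u.
Proof. by rewrite -(mulgV v) mdist_mulr. Qed.

(** The function is the cocycle of T^(- k - r) g T^k. *)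
Lemma centered_translate (g : G) (k r : int) :
  (\int[mu]_x ((cocycle_of g x)%:~R : R)%:E = (r%:~R)%:E)%E ->
  let h y := cocycle_of g (T^ k y) - r in
  [/\ level_measurable h, orbit_bijective T h,
      (\int[mu]_x (`|h x|%:~R : R)%:E < +oo)%E &
      (\int[mu]_x ((h x)%:~R : R)%:E = 0)%E].
Proof.
move=> gr h.
have mg := level_measurable_cocycle_of g.
have mgk : level_measurable (fun y => cocycle_of g (T^ k y)).
  exact: level_measurable_zpow.
have intgk : (\int[mu]_x (`|cocycle_of g (T^ k x)|%:~R : R)%:E < +oo)%E.
  rewrite (integral_norm_mpaut (zpow_mpaut T k)) //.
  exact: integrable_cocycle_of.
split.
- exact: (level_measurable_comp (fun n : int => n - r) mgk).
- exact/orbit_bijective_shift/orbit_bijective_cocycle_of.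
- apply: (@le_lt_trans _ _ (\int[mu]_x ((`|cocycle_of g (T^ k x)|%:~R : R)%:E
      + (`|r|%:~R)%:E))%E).
    apply: ge0_le_integral => //.
    + apply: measurable_norm_int.
      exact: (level_measurable_comp (fun n : int => n - r) mgk).
    + by apply: emeasurable_funD => //; exact: measurable_norm_int.
    + by move=> x _; rewrite -EFinD lee_fin -intrD ler_int ler_normB.
  rewrite ge0_integralD //; last by exact: measurable_norm_int.
  by rewrite integral_cst // [X in (_ * X)%E](probability_setT mu) mule1 lte_add_pinfty ?ltry.
- have intgk' : mu.-integrable setT (EFin \o (fun x => (cocycle_of g (T^ k x))%:~R : R)).
    apply/integrableP; split.
      exact: (level_measurable_fun (fun n : int => (n%:~R : R)%:E) mgk).
    by under eq_integral do rewrite /= -intr_norm.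
  rewrite /h; under eq_integral do rewrite intrB EFinB.
  rewrite integralB_EFin //; last exact: finite_measure_integrable_cst.
  rewrite (integral_mpaut (zpow_mpaut T k)) // gr integral_cst //.
  by rewrite [X in (_ * X)%E](probability_setT mu) mule1 subee.
Qed.

(** The shift by r leaves [0, N) at one end only, and k is then within |r| of
    that end. *)
Lemma card_shift_out (N : nat) (r : int) :
  (#|[set k : 'I_N | ~~ ((0 <= (k : nat)%:Z + r) && ((k : nat)%:Z + r < N%:Z))%R]%SET|
    <= `|r|)%N.
Proof.
pose a := if 0 <= r then (N - `|r|)%N else 0%N.
pose b := if 0 <= r then N else minn `|r| N.
have aN : (a <= N)%N by rewrite /a; case: ifP => // _; exact: leq_subr.
have bN : (b <= N)%N by rewrite /b; case: ifP => // _; exact: geq_minr.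
apply: (@leq_trans `|(a%:Z - b%:Z)%R|%N); last first.
  by rewrite /a /b; case: ifP => r0; lia.
rewrite -(sum_xor_lt aN bN) -sum1dep_card big_mkcond; apply: leq_sum => k _.
by have := ltn_ord k; rewrite /a /b; case: ifP => r0; case: ifP => //; lia.
Qed.

(** The index (k, phi) stands for T^k phi. The injection shifts k by r modulo
    N and multiplies phi by the approximant of T^(- k - r) g T^k; the only bad
    indices are those for which the shift wraps around. *)
Lemma L1_full_group_folner : topological_folner R G.
Proof.
move=> L V e /nbhs_ballP[dlt dlt0 dV] e0.
have /choice[r rP] : forall g : G, exists r : int,
    (\int[mu]_x ((cocycle_of g x)%:~R : R)%:E = (r%:~R)%:E)%E.
  move=> g; have [k [_ kE]] := constant_flow T_ergodic (level_measurable_cocycle_of g)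
    (orbit_bijective_cocycle_of mu_nonatomic T_ergodic g) (integrable_cocycle_of g).
  by exists k.
(* N is chosen larger than |r g| / e for all g in L at once. *)
pose s := (\sum_(g <- L) `|r g|)%N.
pose N' := Num.truncn (s%:R / e); pose N := N'.+1.
have rN g : g \in L -> (`|r g|%N%:R : R) <= e * N%:R.
  move=> gL; apply: (@le_trans _ _ s%:R).
    by rewrite ler_nat /s (big_rem g) //= leq_addr.
  by rewrite mulrC -ler_pdivrMr //; apply: ltW; exact: truncnS_gt.
pose I := ('I_(size L) * 'I_N)%type.
pose gI (i : I) := nth 1%g L i.1.
pose h (i : I) y := cocycle_of (gI i) (T^ (i.2 : nat) y) - r (gI i).
have hP (i : I) := centered_translate (i.2 : nat) (rP (gI i)).
have [J [mul [a [w [M [J0 mulI aP aM ahI]]]]]] :=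
  @finite_group_approximation _ _ _ _ T mu_nonatomic T_ergodic I h dlt dlt0
  (fun i => let: And4 p _ _ _ := hP i in p)
  (fun i => let: And4 _ p _ _ := hP i in p)
  (fun i => let: And4 _ _ p _ := hP i in p)
  (fun i => let: And4 _ _ _ p := hP i in p).
have /choice[rho rhoP] : forall phi : J, exists g : G,
    \forall x \ae mu, cocycle_of g x = a phi x.
  by move=> phi; have [ma aM' abij] := aP phi; exact: (exists_cocycle _ _ ma aM').
have /choice[tau tauP] : forall k : nat, exists g : G,
    \forall x \ae mu, cocycle_of g x = k%:Z.
  move=> k; apply: (@exists_cocycle _ _ _ _ T _ _ (fun=> k%:Z) k) => //.
    exact: level_measurable_cst.
  by exists (T^ (- k%:Z)); [exact: zpowK|exact: zpowNK].
have rhoE phi : \forall x \ae mu, action_of (rho phi) x = T^ (a phi x) x.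
  by apply: filterS2 (cocycle_ofP (rho phi)) (rhoP phi) => x -> ->.
have tauE k : \forall x \ae mu, action_of (tau k) x = T^ k x.
  by apply: filterS2 (cocycle_ofP (tau k)) (tauP k) => x -> ->.
have cM := cocycle_ofM mu_nonatomic T_ergodic.
have tau_rho k phi : \forall x \ae mu,
    cocycle_of (tau k * rho phi)%g x = k%:Z + a phi x.
  apply: filterS3 (cM (tau k) (rho phi))
    (ae_mpaut (action_of (rho phi)) (tauP k)) (rhoP phi) => x -> -> ->.
  by [].
have act_tau_rho (k : nat) phi : \forall x \ae mu,
    action_of (tau k * rho phi)%g x = T^ k (T^ (a phi x) x).
  by apply: filterS3 (repr_AutM (val (tau k)) (val (rho phi)))
    (ae_mpaut (action_of (rho phi)) (tauE k)) (rhoE phi) => x + + <- => <-.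
have close (i : I) (k' : nat) phi : k'%:Z = (i.2 : nat)%:Z + r (gI i) ->
    (mdist (tau k' * rho (mul (w i) phi)) (gI i * (tau i.2 * rho phi)))%g < dlt.
  move=> k'E; rewrite -lte_fin.
  pose D x := h i x - a (w i) x.
  have mD : level_measurable D.
    apply: (level_measurable2 (fun m n : int => m - n)); first by have [] := hP i.
    by have [] := aP (w i).
  rewrite metric_sym (@mdist_ae_eq _ _ _ _ T _ _ (fun x => D (action_of (rho phi) x))).
  - by rewrite integral_norm_mpaut //; exact: ahI.
  - exact: level_measurable_mpaut.
  - have lhs : \forall x \ae mu, cocycle_of (gI i * (tau i.2 * rho phi))%g x =
        cocycle_of (gI i) (T^ (i.2 : nat) (T^ (a phi x) x)) + ((i.2 : nat)%:Z + a phi x).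
      by apply: filterS3 (cM (gI i) (tau i.2 * rho phi)%g) (act_tau_rho i.2 phi)
        (tau_rho i.2 phi) => x -> -> ->.
    apply: filterS3 lhs (tau_rho k' (mul (w i) phi)) (rhoE phi) => x -> -> ->.
    by rewrite aM /D /h; lia.
exists ('I_N * J)%type, (fun j : 'I_N * J => tau j.1 * rho j.2)%g.
split.
  by rewrite card_prod card_ord muln_gt0.
move=> g gL.
have iL : (index g L < size L)%N by rewrite index_mem.
pose i (k : 'I_N) : I := (Ordinal iL, k).
have gi k : gI (i k) = g by rewrite /gI /= nth_index.
have N0 : 0 < N%:Z by [].
have sh_lt (k : 'I_N) : (`|((((k : nat)%:Z + r g)%R) %% N%:Z)%Z|%N < N)%N.
  by have := ltz_pmod ((k : nat)%:Z + r g) N0; have := modz_ge0 ((k : nat)%:Z + r g) (lt0r_neq0 N0); lia.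
exists (fun j : 'I_N * J => (Ordinal (sh_lt j.1), mul (w (i j.1)) j.2)).
  move=> [k phi] [k' phi'] [kk']. 
  have {}kk' : k = k'.
    apply: val_inj; move: kk' => kk'; have := ltn_ord k; have := ltn_ord k' => k'N kN.
    have : ((k : nat)%:Z + r g = (k' : nat)%:Z + r g %[mod N%:Z])%Z.
      have := modz_ge0 ((k : nat)%:Z + r g) (lt0r_neq0 N0).
      have := modz_ge0 ((k' : nat)%:Z + r g) (lt0r_neq0 N0).
      by move: kk'; lia.
    by move/eqP; rewrite eqz_modDr !modz_small ?ltz_nat ?kN ?k'N // => /eqP[].
  by rewrite kk' => /mulI ->.
(* For the other k the remainder modulo N is k + r g itself. *)
pose bad := [set k : 'I_N | ~~ ((0 <= (k : nat)%:Z + r g) && ((k : nat)%:Z + r g < N%:Z))%R]%SET.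
have sub : ([set j : 'I_N * J | `[< ~ V (g * (tau j.1 * rho j.2) *
    (tau (Ordinal (sh_lt j.1)) * rho (mul (w (i j.1)) j.2))^-1)%g >]]%SET
    \subset finset.setX bad finset.setT).
  apply/fintype.subsetP => -[k phi]; rewrite !inE /= andbT.
  apply: contraPN => kr; apply; apply: dV; rewrite ballEmdist /= mdist_divg.
  have := close (i k) (Ordinal (sh_lt k)) phi; rewrite gi; apply.
  by rewrite /= modz_small //; lia.
have := leq_trans (subset_leq_card sub) (leqnn _).
rewrite cardsX cardsT => cb.
apply: (@le_trans _ _ ((`|r g|%N * #|J|)%N%:R)).
  by rewrite ler_nat; apply: leq_trans cb _; rewrite leq_mul2r card_shift_out orbT.
by rewrite natrM card_prod card_ord natrM mulrA ler_wpM2r // rN.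
Qed.

End Folner.

Theorem theorem1p7 (R : realType) (d : measure_display)
    (X : standardBorelType R d) (mu : probability X R) (T : mpaut mu)
    (mu_nonatomic : nonatomic mu) (T_ergodic : ergodic T) :
  amenable R (L1_full_group T).
Proof. exact/folner_amenable/L1_full_group_folner. Qed.
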